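(* Let $(\mathcal U,U,V,V,Z)$ be a CR dual system of metric $f$-structures. Let $\mathscr H$ be a $V$-Hilbert $U$-module satisfying $\mathsf d_{\mathscr H}(v,0)^2\le\mathsf d_Z(|v|^2,0)$ for every $v\in\mathscr H$. Define the operator $\mathrm R_{\mathscr H}\colon\mathscr H\to\mathscr H^*$ as $$\langle\mathrm R_{\mathscr H}(w),v\rangle:=v\cdot w\quad\text{for every }v,w\in\mathscr H.$$ Then $\mathrm R_{\mathscr H}$ is an isomorphism of $V$-Banach $U$-modules, $\mathscr H^*$ is a $V$-Hilbert $U$-module, and $$\mathrm R_{\mathscr H}(v)\cdot\mathrm R_{\mathscr H}(w)=v\cdot w\quad\text{for every }v,w\in\mathscr H.$$
   Context: Riesz spaces and $f$-algebras. $\mathbb R^+=[0,\infty)$. A Riesz space is a real vector space $U$ with a partial order that is a lattice and satisfies $u\le v\Rightarrow u+w\le v+w$ and ($u\ge 0$, $\lambda\in\mathbb R^+$) $\Rightarrow\lambda u\ge 0$; $\vee,\wedge$ denote sup and inf of two elements, $u^{+}=u\vee 0$, $u^-=(-u)\vee 0$, $|u|=u\vee(-u)$, $U^+=\{u\in U:u\ge 0\}$. A Riesz subspace is a linear subspace closed under $\vee,\wedge$; a Riesz subspace $V\subset U$ is solid if $v\in U$, $u\in V$, $|v|\le|u|$ imply $v\in V$. A family is disjoint if $|u|\wedge|v|=0$ for any two different members. Dedekind complete (resp. $\sigma$-complete): every non-empty (resp. countable non-empty) subset bounded above has a supremum and every such subset bounded below has an infimum. A Dedekind complete partially ordered set $P$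 is countably representable (CR) if every non-empty $S\subset P$ bounded above contains a sequence $(s_n)_n\subset S$ with $\sup_ns_n=\sup S$ and every non-empty $S\subset P$ bounded below contains a sequence $(s_n)_n\subset S$ with $\inf_ns_n=\inf S$. An $f$-algebra is a Riesz space with an associative, commutative, $\mathbb R$-bilinear multiplication with unit $\mathbf 1_U$ such that $uv\ge0$ for $u,v\ge 0$, and $(uw)\wedge v=0$ whenever $u\wedge v=0$ and $w\ge 0$. An $f$-subalgebra is a Riesz subspace closed under multiplication and containing $\mathbf 1_U$. $\mathrm{Idem}(U)=\{u\in U:u^2=u\}$. A finite partition of $u\in\mathrm{Idem}(U)$ is a finite disjoint family in $\mathrm{Idem}(U)$ with sum $u$; a countable partition of $u$ is a disjoint family $(u_n)_{n\in\mathbb N}\subset\mathrm{Idem}(U)$ with $\sup_n u_n=u$; $\mathcal P(u)$ is the set of countable partitions of $u$. Simple elements: $\mathcal S(U)=\{\sum_{i=1}^n\lambda_iu_i:\lambda_i\in\mathbb R,\ (u_i)_{i=1}^n\text{ a finite partition of }\mathbf 1_U\}$. An order-preserving map is $\sigma$-order-continuous if it preserves existing suprema of non-decreasing sequences and existing infima of non-increasing sequences; it is order-continuous if it preserves existing suprema of upwards directed sets and existing infima of downwards directed sets. A localisable $f$-algebra is a Dedekind $\sigma$-complete $f$-algebra whose multiplication is $\sigma$-order-continuous on $U^+\times U^+$ and such that every $u\in U^+$ is the supremum of a non-decreasing sequence in $\mathcal S(U)\cap U^+$. Metric notions (products of metric spaces carry the sum distance). A metric Riesz space $(U,\mathsf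 d_U)$ is a Dedekind $\sigma$-complete Riesz space with a complete distance such that $\mathsf d_U(u,0)=\mathsf d_U(|u|,0)$, $\mathsf d_U(u+w,v+w)=\mathsf d_U(u,v)$, and $\mathsf d_U(u,0)\le\mathsf d_U(v,0)$ whenever $0\le u\le v$. A metric $f$-algebra is a localisable $f$-algebra $U$ with a distance $\mathsf d_U$ such that $(U,\mathsf d_U)$ is a metric Riesz space, the multiplication $U\times U\to U$ is continuous, $\mathcal S(U)$ is dense, and $\mathsf d_U(\varepsilon\mathbf 1_U,0)\to0$ as $\varepsilon\searrow0$. A metric $f$-structure is a triple $(\mathcal U,U,V)$ where $\mathcal U$ is a localisable $f$-algebra; $(U,\mathsf d_U)$ is a metric $f$-algebra that is a solid $f$-subalgebra of $\mathcal U$; $(V,\mathsf d_V)$ is a metric Riesz space that is a solid Riesz subspace of $\mathcal U$; $UV=V$ (where $UV=\{uv:u\in U,v\in V\}$) and the multiplication $U\times V\to V$ is continuous; and for any $(u_n)_n\in\mathcal P(\mathbf 1_U)$ and $\varepsilon>0$ there is $\delta>0$ such that, whenever $(v_n)_n\subset V^+$ satisfies $\sum_n\mathsf d_V(u_nv_n,0)\le\delta$, the family $(u_nv_n)_n$ is order-bounded in $V$ and $\mathsf d_V(\sup_nu_nv_n,0)\le\varepsilon$. It is CR if $\mathcal U$, $U$ and $V$ are CR. A dual system of metric $f$-structures is a quintuplet $(\mathcal U,U,V,W,Z)$ such that $(\mathcal U,U,V)$, $(\mathcal U,U,W)$, $(\mathcal U,U,Z)$ are metric $f$-structures, $Z=VW$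 and the multiplication $V\times W\to Z$ is continuous. It is complete if in addition $U,V,W,Z$ are Dedekind complete and the multiplication is order-continuous from $U^+\times V^+$ to $V^+$, from $U^+\times W^+$ to $W^+$, from $U^+\times Z^+$ to $Z^+$ and from $V^+\times W^+$ to $Z^+$. It is CR if it is complete and moreover $(\mathcal U,U,V)$, $(\mathcal U,U,W)$, $(\mathcal U,U,Z)$ are CR. Modules. A $V$-normed $U$-module over a metric $f$-structure $(\mathcal U,U,V)$ is a $U$-module $\mathscr M$ (a real vector space via $\lambda v=(\lambda\mathbf 1_U)\cdot v$) with a map $|\cdot|\colon\mathscr M\to V^+$ such that $|v|=0\iff v=0$, $|v+w|\le|v|+|w|$, $|u\cdot v|=|u||v|$, and the glueing property holds: if $(u_n)_n\in\mathcal P(\mathbf 1_U)$ and $(v_n)_n\subset\mathscr M$ are such that $(|u_n\cdot v_n|)_n$ is order-bounded in $V$, then there is a (necessarily unique) $v\in\mathscr M$ with $u_n\cdot v=u_n\cdot v_n$ for all $n$. $\mathscr M$ has the distance $\mathsf d_{\mathscr M}(v,w)=\mathsf d_V(|v-w|,0)$; if it is complete, $\mathscr M$ is a $V$-Banach $U$-module. An isomorphism of $V$-Banach $U$-modules is a $U$-linear bijection $\Phi$ with $|\Phi v|=|v|$ for all $v$. Dual. For a complete dual system $(\mathcal U,U,V,W,Z)$ and a $V$-normed $U$-module $\mathscr M$, $\mathscr M^*$ is the set of $U$-linear maps $\omega\colon\mathscr M\to Z$ for which there is $w\in W^+$ with $|\omega(v)|\le w|v|$ for all $v$; with pointwise operations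 and $|\omega|:=\inf\{w\in W^+:|\omega(v)|\le w|v|\ \forall v\in\mathscr M\}$ it is a $W$-Banach $U$-module; $\langle\omega,v\rangle:=\omega(v)$. In the claim $W=V$. Hilbert modules. For a dual system $(\mathcal U,U,V,V,Z)$, a $V$-Hilbert $U$-module is a $V$-Banach $U$-module $\mathscr H$ with $|v+w|^2+|v-w|^2=2|v|^2+2|w|^2$ (in $Z$) for all $v,w\in\mathscr H$. Its pointwise scalar product is $v\cdot w:=\frac12(|v+w|^2-|v|^2-|w|^2)\in Z$, which is $U$-bilinear. *)

(* Defs.v *)
From HB Require Import structures.
From mathcomp Require Import all_boot all_order all_algebra ring.
From mathcomp Require Import mathcomp_extra boolp classical_sets functions.
From mathcomp Require Import cardinality reals ereal topology normedtype.
From mathcomp Require Import sequences.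

Set Implicit Arguments.
Unset Strict Implicit.
Unset Printing Implicit Defensive.

Import Order.TTheory GRing.Theory Num.Theory.
Import numFieldNormedType.Exports.
Local Open Scope classical_set_scope.
Local Open Scope ring_scope.
Section Posets.
Context {d d' : Order.disp_t}.
Implicit Types (P : porderType d) (Q : porderType d').

Definition dedekind_complete P : Prop := forall S : set P, S !=set0 ->
  (has_ubound S -> supremums S !=set0) /\ (has_lbound S -> infimums S !=set0).

Definition dedekind_sigma_complete P : Prop :=
  forall S : set P, S !=set0 -> countable S ->
  (has_ubound S -> supremums S !=set0) /\ (has_lbound S -> infimums S !=set0).

Definition countably_representable P : Prop :=
  dedekind_complete P /\
  forall S : set P, S !=set0 ->
  (has_ubound S -> exists2 s : nat -> P, range s `<=` S &
     supremums (range s) = supremums S) /\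
  (has_lbound S -> exists2 s : nat -> P, range s `<=` S &
     infimums (range s) = infimums S).

Definition upwards_directed P (S : set P) : Prop := S !=set0 /\
  forall x y, S x -> S y -> exists z, [/\ S z, (x <= z)%O & (y <= z)%O].

Definition downwards_directed P (S : set P) : Prop := S !=set0 /\
  forall x y, S x -> S y -> exists z, [/\ S z, (z <= x)%O & (z <= y)%O].

Definition sigma_order_continuous P Q (f : P -> Q) : Prop :=
  [/\ {homo f : x y / (x <= y)%O},
      forall (s : nat -> P) x, nondecreasing_seq s ->
        supremums (range s) x -> supremums (range (f \o s)) (f x) &
      forall (s : nat -> P) x, nonincreasing_seq s ->
        infimums (range s) x -> infimums (range (f \o s)) (f x)].

Definition order_continuous P Q (f : P -> Q) : Prop :=
  [/\ {homo f : x y / (x <= y)%O},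
      forall (S : set P) x, upwards_directed S ->
        supremums S x -> supremums (f @` S) (f x) &
      forall (S : set P) x, downwards_directed S ->
        infimums S x -> infimums (f @` S) (f x)].

Definition order_bounded P (I : Type) (s : I -> P) : Prop :=
  has_ubound (range s) /\ has_lbound (range s).

End Posets.

(* The lattice operations belong to the mixin, with the laws of
   Order.POrder_isMeetSemilattice and Order.POrder_isJoinSemilattice, because
   Hierarchy Builder refuses a structure that joins GRing.Zmodule and
   Order.Lattice after Num.RealDomain.  For the same reason the multiplication
   of an f-algebra belongs to its mixin, and its comPzRingType instance is
   derived from it; the zero ring is allowed. *)
HB.mixin Record isRiesz (R : realType) E
    of GRing.Lmodule R E & Order.POrder ring_display E := {
  rmeet : E -> E -> E ;
  rjoin : E -> E -> E ;
  le_rmeet : forall u v w : E, (u <= rmeet v w) = (u <= v) && (u <= w) ;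
  rjoin_le : forall u v w : E, (rjoin u v <= w) = (u <= w) && (v <= w) ;
  riesz_leD2r : forall w u v : E, u <= v -> u + w <= v + w ;
  riesz_scale_ge0 : forall (a : R) (u : E), 0 <= a -> 0 <= u -> 0 <= a *: u }.

#[short(type="rieszType")]
HB.structure Definition Riesz (R : realType) :=
  { E of GRing.Lmodule R E & Order.POrder ring_display E & isRiesz R E }.

HB.mixin Record Riesz_isFAlgebra (R : realType) E of Riesz R E := {
  fmul : E -> E -> E ;
  fone : E ;
  fmulA : associative fmul ;
  fmulC : commutative fmul ;
  fmul1 : left_id fone fmul ;
  fmulDl : left_distributive fmul +%R ;
  fmulZl : forall (a : R) (u v : E), fmul (a *: u) v = a *: fmul u v ;
  fmul_ge0 : forall u v : E, 0 <= u -> 0 <= v -> 0 <= fmul u v ;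
  fmul_disjoint : forall u v w : E,
    rmeet u v = 0 -> 0 <= w -> rmeet (fmul u w) v = 0 }.

#[short(type="fAlgType")]
HB.structure Definition FAlgebra (R : realType) :=
  { E of Riesz R E & Riesz_isFAlgebra R E }.

Section FAlgRing.
Context (R : realType) (E : fAlgType R).
HB.instance Definition _ := GRing.Zmodule_isComPzRing.Build (FAlgebra.sort E)
  (@fmulA R E) (@fmulC R E) (@fmul1 R E) (@fmulDl R E).
End FAlgRing.

HB.mixin Record isRieszClosed (R : realType) (E : rieszType R) (S : {pred E}) := {
  rpred_rmeet : {in S &, forall u v, rmeet u v \in S} ;
  rpred_rjoin : {in S &, forall u v, rjoin u v \in S} }.

#[short(type="rieszClosed")]
HB.structure Definition RieszClosed (R : realType) (E : rieszType R) :=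
  { S of @GRing.SubmodClosed R E S & @isRieszClosed R E S }.

HB.mixin Record isFSubalgClosed (R : realType) (E : fAlgType R)
    (S : {pred E}) := {
  rpred_fone : 1 \in S ;
  rpred_fmul : {in S &, forall u v, u * v \in S} }.

#[short(type="fsubalgClosed")]
HB.structure Definition FSubalgClosed (R : realType) (E : fAlgType R) :=
  { S of @RieszClosed R E S & @isFSubalgClosed R E S }.

Record sub_of (T : Type) (S : {pred T}) : Type :=
  SubOf { sub_val : T ; _ : sub_val \in S }.
HB.instance Definition _ T (S : {pred T}) := [isSub for @sub_val T S].
HB.instance Definition _ (T : choiceType) (S : {pred T}) :=
  [Choice of sub_of S by <:].

Section SubRiesz.
Context (R : realType) (E : rieszType R) (S : rieszClosed E).
HB.instance Definition _ := [SubChoice_isSubLmodule of sub_of S by <:].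
HB.instance Definition _ :=
  [SubChoice_isSubPOrder of sub_of S by <: with ring_display].
Implicit Types u v w : sub_of S.
Definition sub_rmeet u v := SubOf (rpred_rmeet _ _ (valP u) (valP v)).
Definition sub_rjoin u v := SubOf (rpred_rjoin _ _ (valP u) (valP v)).
Fact sub_le_rmeet u v w : (u <= sub_rmeet v w) = (u <= v) && (u <= w).
Proof. by rewrite !leEsub le_rmeet. Qed.
Fact sub_rjoin_le u v w : (sub_rjoin u v <= w) = (u <= w) && (v <= w).
Proof. by rewrite !leEsub rjoin_le. Qed.
Fact sub_leD2r w u v : u <= v -> u + w <= v + w.
Proof. by rewrite !leEsub => /riesz_leD2r; exact. Qed.
Fact sub_scale_ge0 (a : R) u : 0 <= a -> 0 <= u -> 0 <= a *: u.
Proof. by rewrite !leEsub; exact: riesz_scale_ge0. Qed.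
HB.instance Definition _ := isRiesz.Build R (sub_of S)
   sub_le_rmeet sub_rjoin_le sub_leD2r sub_scale_ge0.
End SubRiesz.

Section SubFAlg.
Context (R : realType) (E : fAlgType R) (S : fsubalgClosed E).
Implicit Types u v w : sub_of S.
Definition sub_one : sub_of S := SubOf rpred_fone.
Definition sub_mul u v : sub_of S := SubOf (rpred_fmul _ _ (valP u) (valP v)).
Fact sub_mulA : associative sub_mul.
Proof. by move=> u v w; apply: val_inj; exact: mulrA. Qed.
Fact sub_mulC : commutative sub_mul.
Proof. by move=> u v; apply: val_inj; exact: mulrC. Qed.
Fact sub_mul1 : left_id sub_one sub_mul.
Proof. by move=> u; apply: val_inj; exact: mul1r. Qed.
Fact sub_mulDl : left_distributive sub_mul +%R.
Proof. by move=> u v w; apply: val_inj; exact: mulrDl. Qed.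
Fact sub_mulZl (a : R) u v : sub_mul (a *: u) v = a *: sub_mul u v.
Proof. by apply: val_inj; exact: fmulZl. Qed.
Fact sub_mul_ge0 u v : 0 <= u -> 0 <= v -> 0 <= sub_mul u v.
Proof. by rewrite !leEsub; exact: fmul_ge0. Qed.
Fact sub_mul_disjoint u v w :
  rmeet u v = 0 -> 0 <= w -> rmeet (sub_mul u w) v = 0.
Proof.
move=> uv; rewrite leEsub => w0; apply: val_inj.
exact: (fmul_disjoint _ _ _ (congr1 val uv) w0).
Qed.
HB.instance Definition _ := Riesz_isFAlgebra.Build R (sub_of S)
  sub_mulA sub_mulC sub_mul1 sub_mulDl sub_mulZl sub_mul_ge0 sub_mul_disjoint.
HB.instance Definition _ :=
  GRing.ComPzRing.copy (sub_of S) (FAlgebra.sort (sub_of S)).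
End SubFAlg.

Record pos_of (R : realType) (T : rieszType R) : Type :=
  PosOf { pos_val : T ; _ : 0 <= pos_val }.
HB.instance Definition _ (R : realType) (T : rieszType R) :=
  [isSub for @pos_val R T].
HB.instance Definition _ (R : realType) (T : rieszType R) :=
  [Choice of pos_of T by <:].
HB.instance Definition _ (R : realType) (T : rieszType R) :=
  [SubChoice_isSubPOrder of pos_of T by <: with ring_display].

Section RieszDefs.
Context (R : realType).
Implicit Types (E : rieszType R) (A : fAlgType R).

Definition rabs E (u : E) : E := rjoin u (- u).

(* A family is disjoint for different indices, not for different values. *)
Definition disjoint_family E (I : eqType) (u : I -> E) : Prop :=
  forall i j, i != j -> rmeet (rabs (u i)) (rabs (u j)) = 0.

Definition solid E (S : {pred E}) : Prop :=
  forall u v, u \in S -> rabs v <= rabs u -> v \in S.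

Definition pos0 E : pos_of E := PosOf (lexx (0 : E)).

(* The map induced on the positive cones by m; it takes the value [pos0] where
   m does not preserve positivity, which never happens for multiplications. *)
Definition cone_map (E F G : rieszType R) (m : E -> F -> G)
    (p : (pos_of E *p pos_of F)%type) : pos_of G :=
  insubd (pos0 G) (m (\val p.1) (\val p.2)).

Definition idempotents A : set A := [set u | u * u = u].

Definition finite_partition A (e : A) n (u : 'I_n -> A) : Prop :=
  [/\ forall i, idempotents (u i), disjoint_family u & \sum_i u i = e].

Definition countable_partition A (e : A) (u : nat -> A) : Prop :=
  [/\ forall n, idempotents (u n), disjoint_family u & supremums (range u) e].

Definition simple_elements A : set A :=
  [set s | exists n (l : 'I_n -> R) (u : 'I_n -> A),
     finite_partition 1 u /\ s = \sum_i l i *: u i].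

Record localisable A : Prop := Localisable {
  loc_complete : dedekind_sigma_complete A ;
  loc_mul : sigma_order_continuous (cone_map (fun u v : A => u * v)) ;
  loc_simple : forall u : A, 0 <= u -> exists s : nat -> A,
    [/\ nondecreasing_seq s, forall n, simple_elements (s n) /\ 0 <= s n &
        supremums (range s) u] }.

End RieszDefs.

Section Distances.
Context {R : realType}.

Record is_distance (T : Type) (d : T -> T -> R) : Prop := IsDistance {
  dist_ge0 : forall x y, 0 <= d x y ;
  dist_eq0 : forall x y, d x y = 0 <-> x = y ;
  dist_sym : forall x y, d x y = d y x ;
  dist_triangle : forall x y z, d x z <= d x y + d y z }.

Definition complete_distance (T : Type) (d : T -> T -> R) : Prop :=
  forall s : nat -> T,
    (forall e : R, 0 < e ->
       exists N, forall m n, (N <= m)%N -> (N <= n)%N -> d (s m) (s n) < e) ->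
    exists l, d (s n) l @[n --> \oo] --> (0 : R).

(* Continuity for the sum distance on the product. *)
Definition continuous2 (X Y Z : Type) (dX : X -> X -> R) (dY : Y -> Y -> R)
    (dZ : Z -> Z -> R) (f : X -> Y -> Z) : Prop :=
  forall x y (e : R), 0 < e -> exists2 r : R, 0 < r &
    forall x' y', dX x x' + dY y y' < r -> dZ (f x y) (f x' y') < e.

Record metric_riesz (E : rieszType R) (d : E -> E -> R) : Prop := MetricRiesz {
  mr_sigma_complete : dedekind_sigma_complete E ;
  mr_distance : is_distance d ;
  mr_complete : complete_distance d ;
  mr_abs : forall u, d u 0 = d (rabs u) 0 ;
  mr_translation : forall u v w, d (u + w) (v + w) = d u v ;
  mr_monotone : forall u v, 0 <= u -> u <= v -> d u 0 <= d v 0 }.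

Record metric_falgebra (A : fAlgType R) (d : A -> A -> R) : Prop :=
  MetricFAlgebra {
  mf_localisable : localisable A ;
  mf_metric : metric_riesz d ;
  mf_mul : continuous2 d d d (fun u v : A => u * v) ;
  mf_dense : forall u (e : R), 0 < e -> exists2 s, simple_elements s & d u s < e ;
  mf_unit : d (e *: (1 : A)) 0 @[e --> 0^'+] --> (0 : R) }.

End Distances.

Section Structures.
Context {R : realType} {E : fAlgType R}.

(* The product of E, as a map into the subspace C; it takes the value 0 when
   the product is not in C, which never happens if the products of elements of
   A and B are all in C. *)
Definition smul {A B : rieszClosed E} (C : rieszClosed E)
    (a : sub_of A) (b : sub_of B) : sub_of C :=
  insubd (0 : sub_of C) (\val a * \val b).

Definition mulset (A B : rieszClosed E) : set E :=
  [set \val a * \val b | a in [set: sub_of A] & b in [set: sub_of B]].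

Record metric_fstructure (U : fsubalgClosed E) (V : rieszClosed E)
    (dU : sub_of U -> sub_of U -> R) (dV : sub_of V -> sub_of V -> R) : Prop :=
  MetricFStructure {
  fs_localisable : localisable E ;
  fs_metricU : metric_falgebra dU ;
  fs_solidU : solid U ;
  fs_metricV : metric_riesz dV ;
  fs_solidV : solid V ;
  fs_mulset : mulset U V = [set x | x \in V] ;
  fs_mul : continuous2 dU dV dV (smul V) ;
  fs_sup : forall u : nat -> sub_of U, countable_partition 1 u ->
    forall e : R, 0 < e -> exists2 r : R, 0 < r &
    forall v : nat -> sub_of V, (forall n, 0 <= v n) ->
      (\sum_(0 <= n <oo) (dV (smul V (u n) (v n)) 0)%:E <= r%:E)%E ->
      order_bounded (fun n => smul V (u n) (v n)) /\
      dV (supremum 0 (range (fun n => smul V (u n) (v n)))) 0 <= e }.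

Definition cr_metric_fstructure (U : fsubalgClosed E) (V : rieszClosed E)
    (dU : sub_of U -> sub_of U -> R) (dV : sub_of V -> sub_of V -> R) : Prop :=
  metric_fstructure dU dV /\
  [/\ countably_representable E, countably_representable (sub_of U) &
      countably_representable (sub_of V)].

Record dual_system (U : fsubalgClosed E) (V W Z : rieszClosed E)
    (dU : sub_of U -> sub_of U -> R) (dV : sub_of V -> sub_of V -> R)
    (dW : sub_of W -> sub_of W -> R) (dZ : sub_of Z -> sub_of Z -> R) : Prop :=
  DualSystem {
  ds_V : metric_fstructure dU dV ;
  ds_W : metric_fstructure dU dW ;
  ds_Z : metric_fstructure dU dZ ;
  ds_mulset : mulset V W = [set x | x \in Z] ;
  ds_mul : continuous2 dV dW dZ (smul Z) }.

Record complete_dual_system (U : fsubalgClosed E) (V W Z : rieszClosed E)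
    (dU : sub_of U -> sub_of U -> R) (dV : sub_of V -> sub_of V -> R)
    (dW : sub_of W -> sub_of W -> R) (dZ : sub_of Z -> sub_of Z -> R) : Prop :=
  CompleteDualSystem {
  cds_system : dual_system dU dV dW dZ ;
  cds_U : dedekind_complete (sub_of U) ;
  cds_V : dedekind_complete (sub_of V) ;
  cds_W : dedekind_complete (sub_of W) ;
  cds_Z : dedekind_complete (sub_of Z) ;
  cds_mulUV : order_continuous (cone_map (@smul U V V)) ;
  cds_mulUW : order_continuous (cone_map (@smul U W W)) ;
  cds_mulUZ : order_continuous (cone_map (@smul U Z Z)) ;
  cds_mulVW : order_continuous (cone_map (@smul V W Z)) }.

Record cr_dual_system (U : fsubalgClosed E) (V W Z : rieszClosed E)
    (dU : sub_of U -> sub_of U -> R) (dV : sub_of V -> sub_of V -> R)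
    (dW : sub_of W -> sub_of W -> R) (dZ : sub_of Z -> sub_of Z -> R) : Prop :=
  CRDualSystem {
  crds_complete : complete_dual_system dU dV dW dZ ;
  crds_V : cr_metric_fstructure dU dV ;
  crds_W : cr_metric_fstructure dU dW ;
  crds_Z : cr_metric_fstructure dU dZ }.

End Structures.

Section Modules.
Context {R : realType} {E : fAlgType R} {U : fsubalgClosed E}.

Record normed_module (V : rieszClosed E) (M : lmodType (sub_of U))
    (nrm : M -> sub_of V) : Prop := NormedModule {
  nm_ge0 : forall v, 0 <= nrm v ;
  nm_eq0 : forall v, nrm v = 0 <-> v = 0 ;
  nm_triangle : forall v w, nrm (v + w) <= nrm v + nrm w ;
  nm_scale : forall (u : sub_of U) v,
    \val (nrm (u *: v)) = rabs (\val u) * \val (nrm v) ;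
  nm_glue : forall (u : nat -> sub_of U) (v : nat -> M),
    countable_partition 1 u -> order_bounded (fun n => nrm (u n *: v n)) ->
    exists w, forall n, u n *: w = u n *: v n }.

Definition module_distance (V : rieszClosed E)
    (dV : sub_of V -> sub_of V -> R) (M : lmodType (sub_of U))
    (nrm : M -> sub_of V) (v w : M) : R := dV (nrm (v - w)) 0.

Definition banach_module (V : rieszClosed E)
    (dV : sub_of V -> sub_of V -> R) (M : lmodType (sub_of U))
    (nrm : M -> sub_of V) : Prop :=
  normed_module nrm /\ complete_distance (module_distance dV nrm).

Definition banach_isomorphism (V : rieszClosed E) (M N : lmodType (sub_of U))
    (nrmM : M -> sub_of V) (nrmN : N -> sub_of V) (Phi : M -> N) : Prop :=
  [/\ linear Phi, bijective Phi & forall v, nrmN (Phi v) = nrmM v].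

Definition normsq (V Z : rieszClosed E) (M : lmodType (sub_of U))
    (nrm : M -> sub_of V) (v : M) : sub_of Z := smul Z (nrm v) (nrm v).

Definition hilbert_module (V Z : rieszClosed E)
    (dV : sub_of V -> sub_of V -> R) (M : lmodType (sub_of U))
    (nrm : M -> sub_of V) : Prop :=
  banach_module dV nrm /\ forall v w,
    normsq Z nrm (v + w) + normsq Z nrm (v - w) =
    normsq Z nrm v *+ 2 + normsq Z nrm w *+ 2.

Definition scalar_product (V Z : rieszClosed E) (M : lmodType (sub_of U))
    (nrm : M -> sub_of V) (v w : M) : sub_of Z :=
  (2^-1 : R) *: (normsq Z nrm (v + w) - normsq Z nrm v - normsq Z nrm w).

End Modules.

Section AbsTheory.
Context {R : realType}.

Lemma ler_rabs (E : rieszType R) (u : E) : u <= rabs u.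
Proof. by have := lexx (rabs u); rewrite {1}/rabs rjoin_le => /andP[]. Qed.

Lemma lerN_rabs (E : rieszType R) (u : E) : - u <= rabs u.
Proof. by have := lexx (rabs u); rewrite {1}/rabs rjoin_le => /andP[]. Qed.

Lemma riesz_leD (E : rieszType R) (u v w z : E) :
  u <= v -> w <= z -> u + w <= v + z.
Proof.
move=> uv wz; apply: le_trans (riesz_leD2r w _ _ uv) _.
by rewrite addrC (addrC v); exact: riesz_leD2r.
Qed.

Lemma rabs_le (E : rieszType R) (u v : E) : u <= v -> - u <= v -> rabs u <= v.
Proof. by move=> uv Nuv; rewrite rjoin_le uv. Qed.

Lemma rabsN (E : rieszType R) (u : E) : rabs (- u) = rabs u.
Proof.
apply/le_anti/andP; split; apply: rabs_le; rewrite ?opprK;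
  by [exact: ler_rabs|exact: lerN_rabs|
      rewrite -{1}(opprK u); exact: lerN_rabs].
Qed.

Lemma rabsD (E : rieszType R) (u v : E) : rabs (u + v) <= rabs u + rabs v.
Proof.
by apply: rabs_le; rewrite ?opprD; apply: riesz_leD;
  rewrite ?ler_rabs ?lerN_rabs.
Qed.

Lemma riesz_subr_ge0 (E : rieszType R) (u v : E) : (0 <= v - u) = (u <= v).
Proof.
apply/idP/idP => [/(riesz_leD2r u)|/(riesz_leD2r (- u))].
  by rewrite add0r subrK.
by rewrite subrr.
Qed.

Lemma rabs0 (E : rieszType R) : rabs (0 : E) = 0.
Proof. by apply/le_anti; rewrite ler_rabs rabs_le ?oppr0. Qed.

Lemma rabs_ge0 (E : rieszType R) (u : E) : 0 <= rabs u.
Proof.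
have : 0 <= rabs u + rabs u.
  by rewrite -(subrr u) riesz_leD ?ler_rabs ?lerN_rabs.
rewrite -mulr2n -scaler_nat => /(riesz_scale_ge0 (2^-1 : R)).
by rewrite scalerA mulVf ?pnatr_eq0// scale1r invr_ge0 ler0n; exact.
Qed.

Lemma rabsM_le (A : fAlgType R) (u v : A) : rabs (u * v) <= rabs u * rabs v.
Proof.
have pm (x y : A) : x * y <= rabs x * rabs y.
  have p1 : 0 <= (rabs x - x) * (rabs y + y).
    apply: fmul_ge0; first by rewrite riesz_subr_ge0 ler_rabs.
    by rewrite -{2}(opprK y) riesz_subr_ge0 lerN_rabs.
  have p2 : 0 <= (rabs x + x) * (rabs y - y).
    apply: fmul_ge0; last by rewrite riesz_subr_ge0 ler_rabs.
    by rewrite -{2}(opprK x) riesz_subr_ge0 lerN_rabs.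
  have : 0 <= (rabs x * rabs y - x * y) *+ 2.
    have -> : (rabs x * rabs y - x * y) *+ 2 =
      (rabs x - x) * (rabs y + y) + (rabs x + x) * (rabs y - y) by ring.
    by rewrite -(addr0 0); exact: riesz_leD.
  rewrite -scaler_nat => /(riesz_scale_ge0 (2^-1 : R)).
  rewrite scalerA mulVf ?pnatr_eq0// scale1r invr_ge0 ler0n riesz_subr_ge0.
  exact.
apply: rabs_le; first exact: pm.
by rewrite -mulNr -(rabsN u); exact: pm.
Qed.

End AbsTheory.

Section DualFunctionals.
Context {R : realType} {E : fAlgType R} {U : fsubalgClosed E}.
Context {V Z : rieszClosed E} (W : rieszClosed E).
Context {M : lmodType (sub_of U)} (nrm : M -> sub_of V).
Implicit Types (f g : M -> sub_of Z).

Definition dual_bound f (w : sub_of W) : Prop :=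
  0 <= w /\ forall v, \val (rabs (f v)) <= \val w * \val (nrm v).

Definition is_dual_functional f : Prop :=
  [/\ forall v w, f (v + w) = f v + f w,
      forall (u : sub_of U) v, \val (f (u *: v)) = \val u * \val (f v) &
      exists w, dual_bound f w].

Definition dual_pred : {pred M -> sub_of Z} :=
  [pred f | `[< is_dual_functional f >]].

Fact dual_zmod_closed : zmod_closed dual_pred.
Proof.
split=> [|f g].
  apply/asboolP; split=> [v w|u v|]; first by rewrite addr0.
    by rewrite mulr0.
  by exists 0; split=> [|v]; [exact: lexx|rewrite mul0r [rabs _]rabs0].
move=> /asboolP[fD fZ [a [a0 fa]]] /asboolP[gD gZ [b [b0 gb]]].
apply/asboolP; split=> [v w|u v|].
- by rewrite !fctE fD gD opprD addrACA.
- by rewrite !fctE/= fZ gZ mulrBr.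
- exists (a + b); split=> [|v].
    by rewrite -(addr0 0); exact: riesz_leD.
  rewrite [\val (a + b)]/= mulrDl; apply: le_trans (riesz_leD (fa v) (gb v)).
  by rewrite !fctE -(rabsN (g v)); exact: rabsD.
Qed.
HB.instance Definition _ :=
  GRing.isZmodClosed.Build (M -> sub_of Z) dual_pred dual_zmod_closed.

Record dual_functional : Type :=
  DualFunctional { pairing : M -> sub_of Z ; _ : pairing \in dual_pred }.
HB.instance Definition _ := [isSub for pairing].
HB.instance Definition _ := [Choice of dual_functional by <:].
HB.instance Definition _ := [SubChoice_isSubZmodule of dual_functional by <:].

End DualFunctionals.

Lemma val_smul (R : realType) (E : fAlgType R) (A B C : rieszClosed E)
    (a : sub_of A) (b : sub_of B) :
  mulset A B = [set x | x \in C] -> \val (smul C a b) = \val a * \val b.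
Proof.
move=> ABC; rewrite /smul insubdK//.
suff : [set x | x \in C] (\val a * \val b) by [].
by rewrite -ABC; exists a => //; exists b.
Qed.

Section Dual.
Context {R : realType} {E : fAlgType R} {U : fsubalgClosed E}.
Context {V W Z : rieszClosed E}.
Context {dU : sub_of U -> sub_of U -> R} {dV : sub_of V -> sub_of V -> R}.
Context {dW : sub_of W -> sub_of W -> R} {dZ : sub_of Z -> sub_of Z -> R}.

(* HS serves only the U-module structure, which needs UZ = Z and UW = W. *)
Definition dual (HS : complete_dual_system dU dV dW dZ)
  (M : lmodType (sub_of U)) (nrm : M -> sub_of V) : Type :=
  @dual_functional R E U V Z W M nrm.

Context (HS : complete_dual_system dU dV dW dZ).
Context {M : lmodType (sub_of U)} (nrm : M -> sub_of V).
HB.instance Definition _ := GRing.Zmodule.on (dual HS nrm).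

Let mulUZ := fs_mulset (ds_Z (cds_system HS)).
Let mulUW := fs_mulset (ds_W (cds_system HS)).

Fact dual_scale_subproof (u : sub_of U) (f : dual HS nrm) :
  (fun v => smul Z u (pairing f v)) \in dual_pred W nrm.
Proof.
have /asboolP[fD fZ [w [w0 fw]]] := valP f.
apply/asboolP; split=> [v v'|a v|].
- by apply: val_inj; rewrite /= !val_smul// fD mulrDr.
- by rewrite !val_smul// fZ mulrCA.
- exists (smul W (rabs u) w); split=> [|v].
    by rewrite leEsub val_smul//; apply: fmul_ge0 => //; exact: rabs_ge0.
  rewrite val_smul// -mulrA.
  have -> : \val (rabs (smul Z u (pairing f v))) =
      rabs (\val (smul Z u (pairing f v))) by [].
  rewrite val_smul//; apply: le_trans (rabsM_le _ _) _.
  rewrite -riesz_subr_ge0 -mulrBr.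
  apply: fmul_ge0; first exact: rabs_ge0.
  by rewrite riesz_subr_ge0; exact: fw.
Qed.

Definition dual_scale (u : sub_of U) (f : dual HS nrm) : dual HS nrm :=
  DualFunctional (dual_scale_subproof u f).

Fact dual_scaleA a b f : dual_scale a (dual_scale b f) = dual_scale (a * b) f.
Proof.
apply: val_inj; apply/funext => v; apply: val_inj.
by rewrite /= !val_smul// mulrA.
Qed.
Fact dual_scale1 : left_id 1 dual_scale.
Proof.
move=> f; apply: val_inj; apply/funext => v; apply: val_inj.
by rewrite /= val_smul// mul1r.
Qed.
Fact dual_scaleDr : right_distributive dual_scale +%R.
Proof.
move=> a f g; apply: val_inj; apply/funext => v; apply: val_inj.
by rewrite /= !val_smul// mulrDr.
Qed.
Fact dual_scaleDl f : {morph dual_scale^~ f : a b / a + b}.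
Proof.
move=> a b; apply: val_inj; apply/funext => v; apply: val_inj.
by rewrite /= !val_smul// mulrDl.
Qed.
HB.instance Definition _ := GRing.Zmodule_isLmodule.Build (sub_of U)
  (dual HS nrm) dual_scaleA dual_scale1 dual_scaleDr dual_scaleDl.

Definition dual_norm (f : dual HS nrm) : sub_of W :=
  infimum 0 [set w | dual_bound nrm (pairing f) w].

End Dual.

Arguments dual_norm {R E U V W Z dU dV dW dZ} HS {M} nrm f.

(* Main.v *)
Require Import Defs.
From HB Require Import structures.
From mathcomp Require Import all_boot all_order all_algebra ring.
From mathcomp Require Import boolp classical_sets functions cardinality reals.
From mathcomp Require Import topology normedtype sequences.

Set Implicit Arguments.
Unset Strict Implicit.
Unset Printing Implicit Defensive.

Import Order.TTheory GRing.Theory Num.Theory.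
Import numFieldNormedType.Exports.
Local Open Scope classical_set_scope.
Local Open Scope ring_scope.

(** The representing element of a functional [om] on a Hilbert module is found,
    as in a Hilbert space, by minimizing the energy [|v|^2 - 2 (om v)]; the
    energy takes values in a Riesz space, and this is what the proof must
    overcome.

    Twice the scalar product is the polarization [polar] of the square norm.  The
    parallelogram law makes it additive, and squaring the triangle inequality
    gives the Cauchy-Schwarz inequality.  Homogeneity over the scalars holds for
    idempotents by locality of the norm, for reals by the Archimedean property,
    and in general by density of the simple elements ([polar_scale]).

    If [b] bounds [om], the energy is bounded below by [- b^2], so it has an
    infimum [m], which is the infimum of the energies of a sequence.  This is
    convergence in order only, and the metric need not see it.  Cutting the unit
    along the sets where an energy of the sequence first falls below
    [m + t^2 b^2] gives a countable partition ([egorov_partition]), and glueing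
    the sequence along it gives a single element with energy at most
    [m + t^2 b^2] everywhere ([near_minimizer]).  By the parallelogram law, two
    such elements are at pointwise distance at most [2 t b].  Now the small
    factor [t] multiplies one fixed element [b], whose small multiples are small
    in the metric.  So the near-minimizers are Cauchy, and since the estimates
    hold pointwise they pass to the limit, which satisfies the Euler-Lagrange
    equation [polar h v = 2 (om v)] ([riesz_representation]).

    Hence the Riesz map is onto.  It preserves norms because the functional of
    [w] attains its bound at [w] ([dual_norm_riesz_map]), where cancelling the
    factor [|w|] rests on the absence of nilpotents in the algebra
    ([fsqr_eq0], [le_of_mul_le0]).  The Hilbert module structure of the dual is
    then that of the module, transported along the isomorphism
    ([hilbert_module_transport]). *)


(** * Riesz spaces *)

Lemma countable_range (T : Type) (f : nat -> T) : countable (range f).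
Proof. by apply: sub_countable (card_image_le f setT) _; exact: countableP. Qed.

Section RieszLemmas.
Context {R : realType} {E : rieszType R}.
Implicit Types x y z p q : E.

Definition pospart x : E := rjoin x 0.

Lemma pospart_ge0 x : 0 <= pospart x.
Proof. by have := lexx (pospart x); rewrite rjoin_le => /andP[]. Qed.

Lemma le_pospart x : x <= pospart x.
Proof. by have := lexx (pospart x); rewrite rjoin_le => /andP[]. Qed.

Lemma pospart_le x y : 0 <= y -> x <= y -> pospart x <= y.
Proof. by move=> y0 xy; rewrite rjoin_le xy. Qed.

Lemma pospart_eq0 x : pospart x = 0 -> x <= 0.
Proof. by move=> <-; exact: le_pospart. Qed.

Lemma rmeet_lel x y : rmeet x y <= x.
Proof. by have := lexx (rmeet x y); rewrite le_rmeet => /andP[]. Qed.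

Lemma rmeet_ler x y : rmeet x y <= y.
Proof. by have := lexx (rmeet x y); rewrite le_rmeet => /andP[]. Qed.

Lemma rmeetC x y : rmeet x y = rmeet y x.
Proof. by apply/le_anti; rewrite !le_rmeet !rmeet_lel !rmeet_ler. Qed.

Lemma riesz_addr_ge0 x y : 0 <= x -> 0 <= y -> 0 <= x + y.
Proof. by move=> x0 y0; rewrite -(addr0 0); exact: riesz_leD. Qed.

Lemma riesz_lerDl x y : (x <= x + y) = (0 <= y).
Proof. by rewrite -riesz_subr_ge0 addrAC subrr add0r. Qed.

Lemma riesz_gerDl x y : (x + y <= x) = (y <= 0).
Proof.
by rewrite -[LHS]riesz_subr_ge0 -[RHS]riesz_subr_ge0 opprD addrA subrr.
Qed.

Lemma riesz_mulrn_ge0 x n : 0 <= x -> 0 <= x *+ n.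
Proof.
by move=> x0; elim: n => [//|n IH]; rewrite mulrS; exact: riesz_addr_ge0.
Qed.

Lemma riesz_oppr_le0E x : (- x <= 0) = (0 <= x).
Proof. by rewrite -[LHS]riesz_subr_ge0 sub0r opprK. Qed.

Lemma riesz_subr_le0 x y : (x - y <= 0) = (x <= y).
Proof. by rewrite -[LHS]riesz_subr_ge0 sub0r opprB riesz_subr_ge0. Qed.

Lemma riesz_oppr_le0 x : 0 <= x -> - x <= 0.
Proof. by rewrite riesz_oppr_le0E. Qed.

Lemma rabs_id x : 0 <= x -> rabs x = x.
Proof.
move=> x0; apply/le_anti; rewrite ler_rabs rabs_le//.
exact: le_trans (riesz_oppr_le0 x0) x0.
Qed.

Lemma rmeet_eq0 x y : 0 <= x -> 0 <= y ->
  (forall z, z <= x -> z <= y -> z <= 0) -> rmeet x y = 0.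
Proof.
move=> x0 y0 xy; apply/le_anti; rewrite le_rmeet x0 y0 !andbT.
by apply: xy; [exact: rmeet_lel|exact: rmeet_ler].
Qed.

(** A lower bound [z] of both elements could be subtracted from [pospart x]
    without losing the property of dominating [x] and [0]. *)
Lemma pospart_disjoint x : rmeet (pospart x) (pospart x - x) = 0.
Proof.
apply: rmeet_eq0; rewrite ?pospart_ge0 ?riesz_subr_ge0 ?le_pospart// => z zx zy.
rewrite -riesz_subr_ge0.
have : pospart x <= pospart x - z.
  apply: pospart_le; first by rewrite riesz_subr_ge0.
  rewrite -riesz_subr_ge0; move: zy.
  by rewrite -riesz_subr_ge0 addrAC.
by rewrite -riesz_subr_ge0 addrAC subrr.
Qed.

(** As for [pospart_disjoint]: a common lower bound could be subtracted from
    [rabs x]. *)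
Lemma rabs_disjoint x : rmeet (rabs x - x) (rabs x + x) = 0.
Proof.
apply: rmeet_eq0.
- by rewrite riesz_subr_ge0 ler_rabs.
- by rewrite -{2}(opprK x) riesz_subr_ge0 lerN_rabs.
move=> z; rewrite -riesz_subr_ge0 addrAC riesz_subr_ge0 => zx.
rewrite -riesz_subr_ge0 => zy.
have {}zy : - x <= rabs x - z by rewrite -riesz_subr_ge0 opprK addrAC.
have := rabs_le zx zy.
by rewrite -riesz_subr_ge0 addrAC subrr riesz_subr_ge0.
Qed.

(** The supremum distributes over a binary infimum because every term [s n] is
    at most [rmeet (s n) y + pospart (c - y)]. *)
Lemma rmeet_sup_le (s : nat -> E) c y z : supremums (range s) c ->
  (forall n, rmeet (s n) y <= z) -> rmeet c y <= z.
Proof.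
move=> [ub lub] sz.
have key : c <= z + pospart (c - y).
  apply: lub => _ [n _ <-].
  have : s n - pospart (c - y) <= rmeet (s n) y.
    rewrite le_rmeet; apply/andP; split; rewrite -riesz_subr_ge0.
      by rewrite opprB addrC subrK pospart_ge0.
    have snc : s n <= c by apply: ub; exists n.
    have : s n - y <= pospart (c - y).
      by apply: le_trans (le_pospart _); exact: riesz_leD2r.
    by rewrite -riesz_subr_ge0 !opprB addrCA addrC.
  move/(le_trans)/(_ (sz n))/(riesz_leD2r (pospart (c - y))).
  by rewrite subrK.
have : pospart (c - y) <= c - rmeet c y.
  apply: pospart_le; first by rewrite riesz_subr_ge0 rmeet_lel.
  rewrite (addrC c) (addrC c); apply: riesz_leD2r.
  by rewrite -riesz_subr_ge0 opprK addrC riesz_subr_ge0 rmeet_ler.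
move/(riesz_leD (lexx z))/(le_trans key).
by rewrite addrCA riesz_lerDl riesz_subr_ge0.
Qed.

End RieszLemmas.

(** * Dedekind sigma-complete f-algebras *)

Section FAlgebraLemmas.
Context {R : realType} {E : fAlgType R}.
Implicit Types x y z p q : E.

Lemma scaler_one (t : R) x : t *: x = (t *: (1 : E)) * x.
Proof. by rewrite -[RHS]/(fmul _ _) fmulZl [fmul _ _]mul1r. Qed.

Lemma mulr_scaler (t : R) x y : x * (t *: y) = t *: (x * y).
Proof. by rewrite mulrC [LHS]fmulZl [fmul y x]mulrC. Qed.

Lemma riesz_halfD x : (2^-1 : R) *: x + (2^-1 : R) *: x = x.
Proof. by rewrite -scalerDl -[2^-1]div1r -splitr scale1r. Qed.

Lemma riesz_half_mul2 x : (2^-1 : R) *: (x *+ 2) = x.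
Proof. by rewrite [x *+ 2]mulr2n scalerDr riesz_halfD. Qed.

Lemma mulrSn_eq0 x n : x *+ n.+1 = 0 -> x = 0.
Proof.
move=> /(congr1 (fun y => (n.+1%:R^-1 : R) *: y)) /=.
by rewrite -(scaler_nat _ x) scalerA mulVf ?pnatr_eq0// scale1r scaler0.
Qed.

Lemma rmul_ge0 x y : 0 <= x -> 0 <= y -> 0 <= x * y.
Proof. exact: fmul_ge0. Qed.

Lemma fmul_le x y z : 0 <= z -> x <= y -> x * z <= y * z.
Proof.
move=> z0; rewrite -(riesz_subr_ge0 x) -(riesz_subr_ge0 (x * z)) -mulrBl => xy.
exact: rmul_ge0.
Qed.

Lemma add_eq0 x y : 0 <= x -> 0 <= y -> x + y = 0 -> x = 0.
Proof.
move=> x0 y0 xy0; apply/le_anti; rewrite x0 andbT -xy0 -riesz_subr_ge0.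
by rewrite addrAC subrr add0r.
Qed.

(** Multiplying first one factor and then the other keeps disjointness, so that
    [x * y] is disjoint from itself. *)
Lemma disjoint_mul0 x y : rmeet x y = 0 -> x * y = 0.
Proof.
move=> xy.
have x0 : 0 <= x by rewrite -xy rmeet_lel.
have y0 : 0 <= y by rewrite -xy rmeet_ler.
have : rmeet y (x * y) = 0 by rewrite rmeetC; exact: (fmul_disjoint _ _ _ xy).
move=> /fmul_disjoint/(_ x0) d.
apply/le_anti; rewrite rmul_ge0// andbT -d le_rmeet lexx.
by rewrite -[fmul y x]/(y * x) mulrC lexx.
Qed.

Lemma rabs_sqr x : rabs x * rabs x = x * x.
Proof.
apply/eqP; rewrite -subr_eq0; apply/eqP.
rewrite -(disjoint_mul0 (rabs_disjoint x)); ring.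
Qed.

Lemma fsqr_ge0 x : 0 <= x * x.
Proof. by rewrite -rabs_sqr; apply: rmul_ge0; exact: rabs_ge0. Qed.

Lemma mul_pospart x : pospart x * x = pospart x * pospart x.
Proof.
apply/eqP; rewrite -subr_eq0; apply/eqP.
apply: (@mulrSn_eq0 _ 0); rewrite mulr1n -(oppr0 E).
rewrite -(disjoint_mul0 (pospart_disjoint x)); ring.
Qed.

Section Semiprime.
Hypothesis sc : dedekind_sigma_complete E.

(** If [s] is the supremum of the multiples of [x], then [s - x] is another
    upper bound of them. *)
Lemma riesz_archimedean x y : (forall n, x *+ n <= y) -> x <= 0.
Proof.
move=> xy.
have [] := sc (S := range (fun n => x *+ n)).
- by exists (x *+ 0), 0%N.
- exact: countable_range.
move=> + _ => -[|s [ub lub]]; first by exists y => _ [n _ <-].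
have : s <= s - x.
  apply: lub => _ [n _ <-].
  rewrite -riesz_subr_ge0 -addrA -opprD -mulrS riesz_subr_ge0.
  by apply: ub; exists n.+1.
by rewrite riesz_lerDl => /riesz_oppr_le0; rewrite opprK.
Qed.

(** A nonnegative [p] with zero square is at most [1 / n] for every [n]: on the
    positive part [q] of [n * p - 1] the factor [p] vanishes, so that
    [n * p - 1] is negative there. *)
Lemma fsqr_eq0 p : 0 <= p -> p * p = 0 -> p = 0.
Proof.
move=> p0 pp; apply/le_anti; rewrite p0 andbT.
apply: (@riesz_archimedean _ 1) => n.
have q0 := pospart_ge0 (p *+ n - 1).
have qq := mul_pospart (p *+ n - 1).
move: q0 qq; set q := pospart _ => q0 qq.
have qp : q * p = 0.
  have pq2 : q * p + q * q * p = 0.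
    by rewrite -qq -[RHS](mulr0 (q *+ n)) -pp; ring.
  by apply: (add_eq0 _ _ pq2); do ?apply: rmul_ge0.
have /pospart_eq0 : q = 0.
  apply: (@add_eq0 _ (q * q)) => //; first exact: rmul_ge0.
  by rewrite -qq -[RHS](mul0rn _ n) -qp; ring.
by rewrite riesz_subr_le0.
Qed.

(** The square of [rmeet x y] is at most [x * y]. *)
Lemma mul0_disjoint x y : 0 <= x -> 0 <= y -> x * y = 0 -> rmeet x y = 0.
Proof.
move=> x0 y0 xy.
have m0 : 0 <= rmeet x y by rewrite le_rmeet x0.
apply: fsqr_eq0 => //; apply/le_anti; rewrite rmul_ge0// andbT -xy.
apply: le_trans (fmul_le m0 (rmeet_lel x y)) _.
by rewrite ![x * _]mulrC; apply: fmul_le => //; exact: rmeet_ler.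
Qed.

(** Cancellation of a factor [r] that dominates [x - y]: the positive part [p]
    of [x - y] satisfies [p ^ 3 <= p ^ 2 * r = p * (x - y) * r <= 0]. *)
Lemma le_of_mul_le0 x y r :
  0 <= r -> x - y <= r -> (x - y) * r <= 0 -> x <= y.
Proof.
move=> r0 xyr le0; set p := pospart (x - y).
have p0 : 0 <= p := pospart_ge0 _.
have p3 : p * (p * p) = 0.
  apply/le_anti/andP; split; last by do ?apply: rmul_ge0.
  have pr : p <= r by exact: pospart_le.
  apply: le_trans (fmul_le _ pr) _; first exact: rmul_ge0.
  rewrite -mul_pospart -/p.
  rewrite -(mul0r p); have -> : r * (p * (x - y)) = (x - y) * r * p by ring.
  exact: fmul_le.
have : p = 0.
  apply: fsqr_eq0 => //; apply: fsqr_eq0; first exact: rmul_ge0.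
  by rewrite -[RHS](mulr0 p) -p3; ring.
by move/pospart_eq0; rewrite riesz_subr_le0.
Qed.

Lemma le_of_sqr x y : 0 <= x -> 0 <= y -> x * x <= y * y -> x <= y.
Proof.
move=> x0 y0 xy; apply: (@le_of_mul_le0 _ _ (x + y)).
- exact: riesz_addr_ge0.
- rewrite -riesz_subr_ge0.
  have -> : x + y - (x - y) = y + y by ring.
  exact: riesz_addr_ge0.
- move: xy; rewrite -riesz_subr_ge0 => /riesz_oppr_le0.
  by have -> : - (y * y - x * x) = (x - y) * (x + y) by ring.
Qed.

(** The indicator of the set where [p] is positive is the supremum [c] of the
    truncations [rmeet (n * p) 1].  It is idempotent because [2 * c], truncated
    at [1], is again at most [c].  It fixes [p] because a common lower bound [z]
    of [1 - c] and [p] satisfies [n * z <= c] for every [n], by induction. *)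
Lemma carrier_idempotent p : 0 <= p -> exists c : E,
  [/\ c * c = c, 0 <= c, c <= 1, p * c = p &
      forall q, 0 <= q -> q * p = 0 -> q * c = 0].
Proof.
move=> p0.
have one0 : 0 <= 1 :> E by rewrite -(mul1r 1); exact: fsqr_ge0.
pose s n := rmeet (p *+ n) 1.
have [] := sc (S := range s).
- by exists (s 0%N), 0%N.
- exact: countable_range.
move=> + _ => -[|c supc].
  by exists 1 => _ [n _ <-]; exact: rmeet_ler.
have [ub lub] := supc.
have c0 : 0 <= c.
  apply: le_trans (ub _ (ex_intro2 _ _ 0%N _ erefl)) => //.
  by rewrite le_rmeet lexx.
have c1 : c <= 1 by apply: lub => _ [n _ <-]; exact: rmeet_ler.
have cc : c * (1 - c) = 0.
  apply: disjoint_mul0; apply: rmeet_eq0 => //; first by rewrite riesz_subr_ge0.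
  move=> z zc z1c.
  have : rmeet (c + c) 1 <= c.
    apply: (@rmeet_sup_le _ _ (fun n => s n + s n)) => [|n].
      split=> [_ [n _ <-]|u uu].
        by apply: riesz_leD; apply: ub; exists n.
      suff : c <= 2^-1 *: u.
        by move=> cu; have := riesz_leD cu cu; rewrite riesz_halfD.
      apply: lub => _ [n _ <-].
      have /uu : range (fun n => s n + s n) (s n + s n) by exists n.
      rewrite -riesz_subr_ge0 => /(riesz_scale_ge0 (2^-1 : R)).
      rewrite scalerBr scalerDr riesz_halfD riesz_subr_ge0 invr_ge0 ler0n; exact.
    apply: le_trans (ub _ (ex_intro2 _ _ (n + n)%N _ erefl)) => //.
    rewrite le_rmeet rmeet_ler andbT mulrnDr.
    apply: le_trans (rmeet_lel _ _) _.
    by apply: riesz_leD; exact: rmeet_lel.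
  have : z + c <= rmeet (c + c) 1.
    rewrite le_rmeet (riesz_leD2r c _ _ zc) /=.
    by rewrite -(subrK c 1); exact: riesz_leD2r.
  by move=> /le_trans h /h; rewrite addrC riesz_gerDl.
exists c; split=> //.
- by rewrite -{3}(mulr1 c) -(subrK c 1) addrC mulrDr cc addr0.
- suff : p * (1 - c) = 0.
    by rewrite mulrBr mulr1 => /eqP; rewrite subr_eq0 => /eqP.
  rewrite mulrC; apply: disjoint_mul0; apply: rmeet_eq0 => //.
    by rewrite riesz_subr_ge0.
  move=> z z1c zp; apply: (@riesz_archimedean _ c) => n.
  elim: n => [//|n IH].
  apply: le_trans (ub _ (ex_intro2 _ _ n.+1 _ erefl)) => //.
  rewrite le_rmeet; apply/andP; split.
    by elim: {IH} n => [//|n IH]; rewrite mulrS (mulrS p); exact: riesz_leD.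
  by rewrite -(subrK c 1) mulrS; exact: riesz_leD.
- move=> q q0 qp; apply: disjoint_mul0.
  rewrite rmeetC; apply/le_anti; rewrite le_rmeet c0 q0 !andbT.
  apply: (rmeet_sup_le supc) => n.
  rewrite -(mul0_disjoint (riesz_mulrn_ge0 n p0) q0); last first.
    by rewrite mulrC mulrnAr qp mul0rn.
  by rewrite le_rmeet rmeet_ler andbT (le_trans (rmeet_lel _ _))// rmeet_lel.
Qed.
End Semiprime.
End FAlgebraLemmas.


(** * Countable partitions of the unit *)

Section Partitions.
Context {R : realType} {E : fAlgType R} {U : fsubalgClosed E}.
Hypothesis sc : dedekind_sigma_complete E.
Hypothesis solidU : solid U.
Implicit Types x y z s : E.

Lemma one_ge0 : 0 <= 1 :> E.
Proof. by rewrite -[leRHS]mul1r; exact: fsqr_ge0. Qed.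

Lemma idempotent_ge0 x : x * x = x -> 0 <= x.
Proof. by move=> <-; exact: fsqr_ge0. Qed.

Lemma idempotent_le1 x : x * x = x -> x <= 1.
Proof.
move=> xx; rewrite -riesz_subr_ge0; apply: idempotent_ge0.
by rewrite mulrBr mulr1 mulrBl mul1r xx subrr subr0.
Qed.

Lemma in_unit_interval x : 0 <= x -> x <= 1 -> x \in U.
Proof.
move=> x0 x1; apply: (solidU (rpred_fone (s := U))).
by rewrite !rabs_id// one_ge0.
Qed.

(** If [s] were not zero, then [1 - rmeet s 1] would be an upper bound of the
    [e n] that is smaller than [1]. *)
Lemma partition_separates (e : nat -> sub_of U) s : countable_partition 1 e ->
  0 <= s -> (forall n, \val (e n) * s = 0) -> s = 0.
Proof.
move=> [idem _ [ub lub]] s0 es.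
have q0 : 0 <= rmeet s 1 by rewrite le_rmeet s0 one_ge0.
have q1 := rmeet_ler s 1.
pose b : sub_of U := SubOf (in_unit_interval q0 q1).
have e1b n : e n <= 1 - b.
  have ee : \val (e n) * \val (e n) = \val (e n) := congr1 val (idem n).
  have e0 := idempotent_ge0 ee.
  have eb : \val (e n) * rmeet s 1 = 0.
    apply/le_anti; rewrite rmul_ge0// andbT -(es n) mulrC (mulrC _ s).
    by apply: fmul_le => //; exact: rmeet_lel.
  suff : \val (e n) <= 1 - rmeet s 1 by [].
  rewrite -[\val (e n)]mulr1 -[X in _ * X](subrK (rmeet s 1)) mulrDr eb addr0.
  rewrite -[leRHS]mul1r; apply: fmul_le; first by rewrite riesz_subr_ge0.
  exact: idempotent_le1.
have : (1 : sub_of U) <= (1 - b : sub_of U) by apply: lub => _ [n _ <-].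
rewrite riesz_lerDl => le0.
have {le0} : 0 <= - rmeet s 1 := le0.
move=> /riesz_oppr_le0; rewrite opprK => le0.
rewrite -(mulr1 s); apply: disjoint_mul0.
by apply/le_anti; rewrite le0 q0.
Qed.

(** An abstract form of Egorov's argument: [e n] is the indicator of the set
    where [n] is the first index with [x n <= z].  On what these sets leave
    uncovered, [z] is a lower bound of all the [x n], hence [z] vanishes there
    by the last hypothesis; but where [z] vanishes so does [x 0], and such
    points are covered by the first set. *)
Lemma egorov_partition (x : nat -> E) z (k : R) : 0 <= z ->
  (forall n, 0 <= x n) -> x 0%N <= k *: z ->
  (forall y, 0 <= y -> y <= z -> (forall n, y <= x n) -> y = 0) ->
  exists e : nat -> sub_of U, countable_partition 1 e /\
    forall n, \val (e n) * x n <= \val (e n) * z.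
Proof.
move=> z0 x0 x0z xinf.
pose p n := pospart (x n - z).
have p0 n : 0 <= p n := pospart_ge0 _.
have /choice[c cP] := fun n => carrier_idempotent sc (p0 n).
pose g n := \prod_(i < n) c i.
have gS n : g n.+1 = g n * c n by rewrite /g big_ord_recr.
have g1 : g 0%N = 1 by rewrite /g big_ord0.
have gg n : g n * g n = g n.
  elim: n => [|n IH]; first by rewrite g1 mulr1.
  by have [cc _ _ _ _] := cP n; rewrite gS -{3}IH -{3}cc; ring.
have gc n m : (n < m)%N -> g m * c n = g m.
  elim: m => [//|m IH]; rewrite ltnS leq_eqVlt => /predU1P[->|/IH gm].
    by have [cc _ _ _ _] := cP m; rewrite gS -mulrA cc.
  by rewrite gS mulrAC gm.
pose e n := (1 - c n) * g n.
have ee n : e n * e n = e n.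
  have [cc _ _ _ _] := cP n.
  have c'c' : (1 - c n) * (1 - c n) = 1 - c n.
    by rewrite mulrBr mulr1 mulrBl mul1r cc subrr subr0.
  by rewrite /e -{3}c'c' -{3}gg; ring.
pose eU n : sub_of U :=
  SubOf (in_unit_interval (idempotent_ge0 (ee n)) (idempotent_le1 (ee n))).
have e0 n : 0 <= e n := idempotent_ge0 (ee n).
have eU0 n : 0 <= eU n := e0 n.
have edisj n m : (n < m)%N -> e n * e m = 0.
  move=> nm; rewrite /e -(gc _ _ nm).
  have [cc _ _ _ _] := cP n.
  have -> : (1 - c n) * g n * ((1 - c m) * (g m * c n)) =
    (c n - c n * c n) * g n * ((1 - c m) * g m) by ring.
  by rewrite cc subrr !mul0r.
exists eU; split; first split=> [n|n m nm|].
- by apply: val_inj; exact: ee.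
- rewrite !rabs_id//; apply: val_inj.
  apply: (mul0_disjoint sc); [exact: eU0|exact: eU0|].
  by move: nm; rewrite neq_ltn => /orP[/edisj//|/edisj]; rewrite mulrC.
- split=> [_ [n _ <-]|b bub]; first exact: (idempotent_le1 (ee n)).
  (* [q * q] is a substitute for the indicator of the set where the upper bound
     [b] stays below [1], which is part of the uncovered set. *)
  set q := pospart (1 - \val b).
  have q0 : 0 <= q := pospart_ge0 _.
  have eb n : e n <= \val b by apply: (bub (eU n)); exists n.
  have q1 : q <= 1.
    apply: pospart_le; first exact: one_ge0.
    rewrite -riesz_subr_ge0 opprB addrC subrK.
    exact: le_trans (e0 0%N) (eb 0%N).
  have qq1 : q * q <= 1.
    by apply: le_trans (fmul_le q0 q1) _; rewrite mul1r.
  have eqq n : e n * (q * q) = 0.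
    apply/le_anti/andP; split; last exact: rmul_ge0 (e0 n) (fsqr_ge0 _).
    rewrite -mul_pospart -/q.
    have -> : e n * (q * (1 - \val b)) = (e n * (1 - \val b)) * q by ring.
    rewrite -(mul0r q); apply: fmul_le => //.
    have <- : e n * (1 - e n) = 0 by rewrite mulrBr mulr1 ee subrr.
    rewrite mulrC (mulrC (e n)); apply: fmul_le => //.
    rewrite -riesz_subr_ge0.
    have -> : 1 - e n - (1 - \val b) = \val b - e n by ring.
    by rewrite riesz_subr_ge0.
  have gqq n : g n * (q * q) = q * q.
    elim: n => [|n IH]; first by rewrite g1 mul1r.
    by rewrite -[RHS]IH gS -[LHS]addr0 -(eqq n) /e; ring.
  have cqq n : q * q * c n = q * q.
    by rewrite -(gqq n.+1) mulrAC gc.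
  have qqz : q * q * z = 0.
    apply: xinf.
    - by apply: rmul_ge0 => //; exact: rmul_ge0.
    - by rewrite -{2}(mul1r z); exact: fmul_le.
    move=> n; apply: le_trans (_ : q * q * x n <= _); last first.
      by rewrite -{2}(mul1r (x n)); exact: fmul_le.
    have [_ _ _ _ cq] := cP n.
    have rc : (p n - (x n - z)) * c n = 0.
      apply: cq; first by rewrite riesz_subr_ge0 le_pospart.
      by rewrite mulrC disjoint_mul0// pospart_disjoint.
    rewrite -riesz_subr_ge0 -mulrBr -{1}(cqq n).
    have -> : q * q * c n * (x n - z) = q * q * c n * p n
      - q * q * ((p n - (x n - z)) * c n) by ring.
    rewrite rc mulr0 subr0 -mulrA; apply: rmul_ge0; first exact: rmul_ge0.
    by apply: rmul_ge0 => //; have [] := cP n.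
  have qqp : q * q * p 0%N = 0.
    apply/le_anti/andP; split; last by do ?apply: rmul_ge0.
    apply: (@le_trans _ _ (q * q * x 0%N)).
      rewrite ![q * q * _]mulrC; apply: fmul_le; first exact: rmul_ge0.
      apply: pospart_le => //; rewrite -riesz_subr_ge0 opprB addrC subrK//.
    have <- : q * q * (k *: z) = 0 by rewrite scaler_one mulrCA qqz mulr0.
    by rewrite ![q * q * _]mulrC; apply: fmul_le => //; exact: rmul_ge0.
  have qq : q * q = 0.
    rewrite -(cqq 0%N); have [_ _ _ _] := cP 0%N; apply => //.
    exact: rmul_ge0.
  have /pospart_eq0 : q = 0 by exact: (fsqr_eq0 sc).
  by rewrite riesz_subr_le0.
- move=> n; rewrite -riesz_subr_ge0 -mulrBr.
  have [_ _ _ pc cq] := cP n.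
  have -> : z - x n = (p n - (x n - z)) - p n by ring.
  rewrite mulrBr.
  have -> : \val (eU n) * p n = 0.
    have -> : \val (eU n) * p n = g n * (p n - p n * c n) by rewrite /= /e; ring.
    by rewrite pc subrr mulr0.
  rewrite subr0; apply: rmul_ge0; first exact: e0.
  by rewrite riesz_subr_ge0 le_pospart.
Qed.

End Partitions.



(** * The pointwise scalar product *)

(** Additivity and the zero at [1] make [f] periodic with period [1], hence
    bounded by [C] on the nonnegative reals; then every multiple of [f t] is
    bounded by [C]. *)
Lemma additive_bounded_eq0 (R : realType) (E : fAlgType R)
    (sc : dedekind_sigma_complete E) (f : R -> E) (C : E) :
  (forall s t, f (s + t) = f s + f t) -> f 1 = 0 ->
  (forall t, 0 <= t -> t <= 1 -> rabs (f t) <= C) -> forall t, f t = 0.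
Proof.
move=> fD f1 fC.
have f0 : f 0 = 0 by apply: (addrI (f 0)); rewrite -fD !addr0.
have fnat n : f n%:R = 0.
  by elim: n => [//|n IH]; rewrite -addn1 natrD fD IH f1 addr0.
have fMn t n : f t *+ n = f (t *+ n).
  by elim: n => [|n IH]; rewrite ?f0// !mulrS fD IH.
have key t n : 0 <= t -> rabs (f t *+ n) <= C.
  move=> t0; have tn0 : 0 <= t *+ n by rewrite mulrn_wge0.
  rewrite fMn -(subrK (Num.truncn (t *+ n))%:R (t *+ n)) fD fnat addr0.
  apply: fC; first by rewrite subr_ge0 truncn_le.
  by rewrite lerBlDr addrC natr1 ltW// truncnS_gt.
have pos t : 0 <= t -> f t = 0.
  move=> t0; apply/le_anti/andP; split.
    by apply: (riesz_archimedean sc) => n; exact: le_trans (ler_rabs _) (key t n t0).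
  rewrite -riesz_oppr_le0E.
  apply: (riesz_archimedean sc) => n; rewrite mulNrn.
  exact: le_trans (lerN_rabs _) (key t n t0).
move=> t; have [/pos//|/ltW t0] := leP 0 t.
by rewrite -[RHS]f0 -(addrN t) fD (pos (- t)) ?oppr_ge0// addr0.
Qed.

Section Polarization.
Context {R : realType} {E : fAlgType R} {U : fsubalgClosed E}.
Context {V : rieszClosed E} {H : lmodType (sub_of U)} (nrm : H -> sub_of V).
Hypothesis sc : dedekind_sigma_complete E.
Hypothesis nm : normed_module nrm.
Implicit Types v w : H.

Definition sqnorm v : E := \val (nrm v) * \val (nrm v).

(** Twice the scalar product.  It takes values in the ambient algebra, where all
    products of norms and scalars are available without membership conditions. *)
Definition polar v w : E := sqnorm (v + w) - sqnorm v - sqnorm w.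

Hypothesis parallelogram : forall v w,
  sqnorm (v + w) + sqnorm (v - w) = sqnorm v *+ 2 + sqnorm w *+ 2.

Local Notation N v := (\val (nrm v)).

Lemma nrm_ge0 v : 0 <= N v.
Proof. exact: (nm_ge0 nm). Qed.

Lemma nrm_triangle v w : N (v + w) <= N v + N w.
Proof. exact: (nm_triangle nm). Qed.

Lemma nrmN v : N (- v) = N v.
Proof.
by rewrite -scaleN1r (nm_scale nm) rabsN rabs_id ?mul1r// one_ge0.
Qed.

Lemma sqnorm0 : sqnorm 0 = 0.
Proof. by rewrite /sqnorm (_ : nrm 0 = 0) ?mul0r//; exact/(nm_eq0 nm). Qed.

Lemma sqnorm_scale (u : sub_of U) v :
  sqnorm (u *: v) = \val u * \val u * sqnorm v.
Proof. by rewrite /sqnorm (nm_scale nm) -(rabs_sqr (\val u)); ring. Qed.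

Lemma sqnorm_idem (e : sub_of U) v :
  idempotents e -> \val e * sqnorm v = sqnorm (e *: v).
Proof.
by move=> /(congr1 val) /= ee; rewrite sqnorm_scale [\val e * \val e]ee.
Qed.

Lemma polarC v w : polar v w = polar w v.
Proof. by rewrite /polar (addrC v) addrAC. Qed.

Lemma polar_self v : polar v v = sqnorm v *+ 2.
Proof.
have := parallelogram v v; rewrite subrr sqnorm0 addr0 /polar => ->; ring.
Qed.

(** The Cauchy-Schwarz inequality is the square of the triangle inequality. *)
Lemma polar_le v w : polar v w <= N v * N w *+ 2.
Proof.
have a0 := nrm_ge0 (v + w).
have b0 := riesz_addr_ge0 (nrm_ge0 v) (nrm_ge0 w).
have ab := nrm_triangle v w.
have : sqnorm (v + w) <= (N v + N w) * (N v + N w).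
  apply: le_trans (fmul_le a0 ab) _; rewrite mulrC; exact: fmul_le.
rewrite -riesz_subr_ge0 -(riesz_subr_ge0 (polar v w)) /polar.
rewrite -[sqnorm v]/(N v * N v) -[sqnorm w]/(N w * N w).
set a := N v; set b := N w; set c := sqnorm _.
by have -> : (a + b) * (a + b) - c = a * b *+ 2 - (c - a * a - b * b) by ring.
Qed.

(** The Jordan-von Neumann computation. *)
Lemma polarDl v v' w : polar (v + v') w = polar v w + polar v' w.
Proof.
have p1 := parallelogram (v + w) v'.
have p2 := parallelogram (v - v') w.
have p3 := parallelogram v (v' + w).
have p4 := parallelogram v v'.
have e1 : v + w + v' = v + v' + w by rewrite addrAC.
have e2 : v + w - v' = v - v' + w by rewrite addrAC.
have e3 : v + (v' + w) = v + v' + w by rewrite addrA.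
have e4 : v - (v' + w) = v - v' - w by rewrite opprD addrA.
rewrite e1 e2 in p1; rewrite e3 e4 in p3.
apply/eqP; rewrite -subr_eq0; apply/eqP; apply: (@mulrSn_eq0 _ _ _ 1).
rewrite /polar; move: p1 p2 p3 p4.
set A := sqnorm (v + v' + w); set B := sqnorm (v - v' + w).
set D := sqnorm (v - v' - w); set F := sqnorm (v + w).
set G := sqnorm (v' + w); set I := sqnorm (v + v'); set J := sqnorm (v - v').
set K := sqnorm v; set L := sqnorm v'; set M := sqnorm w.
move=> p1 p2 p3 p4.
have -> : (A - I - M - (F - K - M + (G - L - M))) *+ 2 =
  (A + B - (F *+ 2 + L *+ 2)) - (B + D - (J *+ 2 + M *+ 2))
  + (A + D - (K *+ 2 + G *+ 2)) - (I + J - (K *+ 2 + L *+ 2)) *+ 2 by ring.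
by rewrite p1 p2 p3 p4; ring.
Qed.

Lemma polar0l w : polar 0 w = 0.
Proof. by rewrite /polar add0r sqnorm0 subr0 subrr. Qed.

Lemma polarNl v w : polar (- v) w = - polar v w.
Proof.
by apply/eqP; rewrite -subr_eq0 opprK -polarDl addrC subrr polar0l.
Qed.

Lemma rabs_polar_le v w : rabs (polar v w) <= N v * N w *+ 2.
Proof.
apply: rabs_le; first exact: polar_le.
by rewrite -polarNl -(nrmN v); exact: polar_le.
Qed.

(** The square norm of [e *: v + w] agrees with that of [v + w] on the support
    of [e], and with that of [w] on its complement. *)
Lemma polar_idem (e : sub_of U) v w :
  idempotents e -> polar (e *: v) w = \val e * polar v w.
Proof.
move=> ee.
have e'e' : idempotents (1 - e : sub_of U).
  rewrite /idempotents /= mulrBr mulr1 mulrBl mul1r.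
  by rewrite (_ : e * e = e)// subrr subr0.
have q1 : \val e * sqnorm (e *: v + w) = \val e * sqnorm (v + w).
  rewrite !sqnorm_idem// !scalerDr scalerA.
  by rewrite (_ : e * e = e).
have q2 : \val (1 - e : sub_of U) * sqnorm (e *: v + w) =
    \val (1 - e : sub_of U) * sqnorm w.
  rewrite !sqnorm_idem// !scalerDr scalerA mulrBl mul1r.
  by rewrite (_ : e * e = e)// subrr scale0r add0r.
have {}q2 : (1 - \val e) * sqnorm (e *: v + w) = (1 - \val e) * sqnorm w := q2.
rewrite /polar -(sqnorm_idem v ee).
have -> : sqnorm (e *: v + w) =
  \val e * sqnorm (e *: v + w) + (1 - \val e) * sqnorm (e *: v + w) by ring.
by rewrite q1 q2; ring.
Qed.

Lemma polar_scale_bound (u : sub_of U) v w :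
  rabs (polar (u *: v) w - \val u * polar v w) <=
  rabs (\val u) * (N v * N w *+ 4).
Proof.
have h1 := rabs_polar_le (u *: v) w.
have h2 : rabs (\val u * polar v w) <= (rabs (\val u) : E) * (N v * N w *+ 2).
  apply: le_trans (rabsM_le _ _) _; rewrite mulrC (mulrC (rabs (\val u) : E)).
  by apply: fmul_le; [exact: rabs_ge0|exact: rabs_polar_le].
apply: le_trans (rabsD _ _) _; rewrite rabsN.
apply: le_trans (riesz_leD h1 h2) _; rewrite (nm_scale nm) le_eqVlt.
by apply/orP; left; apply/eqP; ring.
Qed.

(** The defect of homogeneity is additive in [t] and bounded on the unit
    interval. *)
Lemma polar_scale_real (t : R) v w :
  polar ((t *: (1 : sub_of U) : sub_of U) *: v) w = t *: polar v w.
Proof.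
pose i (s : R) : sub_of U := s *: (1 : sub_of U).
have iE s : \val (i s) = s *: (1 : E) by [].
pose f s := polar (i s *: v) w - s *: polar v w.
suff : f t = 0 by move/eqP; rewrite subr_eq0 => /eqP.
apply: (additive_bounded_eq0 sc (C := N v * N w *+ 4)) => [r s||r r0 r1].
- by rewrite /f /i scalerDl scalerDl polarDl [(r + s) *: _]scalerDl; ring.
- by rewrite /f /i !scale1r subrr.
- apply: le_trans (_ : rabs (\val (i r)) * (N v * N w *+ 4) <= _).
    by rewrite /f scaler_one -iE; exact: polar_scale_bound.
  rewrite -[leRHS]mul1r; apply: fmul_le.
    by apply/riesz_mulrn_ge0/rmul_ge0; exact: nrm_ge0.
  rewrite iE rabs_id; last by apply: riesz_scale_ge0 => //; exact: one_ge0.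
  rewrite -[leRHS]scale1r -riesz_subr_ge0 -scalerBl.
  by apply: riesz_scale_ge0; rewrite ?subr_ge0//; exact: one_ge0.
Qed.

Lemma polar_simple (u : sub_of U) v w :
  simple_elements u -> polar (u *: v) w = \val u * polar v w.
Proof.
move=> [n [l [e [[ee _ _] ->]]]].
elim/big_rec : _ => [|i u' _ IH]; first by rewrite scale0r polar0l mul0r.
have -> : l i *: e i + u' = (l i *: (1 : sub_of U) : sub_of U) * e i + u'.
  by rewrite -scaler_one.
rewrite scalerDl polarDl IH -scalerA polar_scale_real polar_idem//.
by rewrite scaler_one /=; ring.
Qed.

End Polarization.

(** * Metric estimates *)

Section MetricRiesz.
Context {R : realType} {E : rieszType R} {d : E -> E -> R}.
Hypothesis md : metric_riesz d.
Implicit Types x y : E.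

Lemma dist_rabs_le x y : rabs x <= y -> d x 0 <= d y 0.
Proof.
by move=> xy; rewrite (mr_abs md); apply: (mr_monotone md) => //; exact: rabs_ge0.
Qed.

Lemma dist_small_eq0 x : (forall e : R, 0 < e -> d x 0 < e) -> x = 0.
Proof.
move=> small; apply/(dist_eq0 (mr_distance md))/le_anti/andP; split.
  by apply/ler_addgt0Pr => e e0; rewrite add0r ltW// small.
exact: dist_ge0 (mr_distance md) _ _.
Qed.

Lemma dist_subr x y : d (x - y) 0 = d x y.
Proof. by rewrite -(mr_translation md _ _ y) subrK add0r. Qed.

End MetricRiesz.

Section MetricFStructure.
Context {R : realType} {E : fAlgType R} {U : fsubalgClosed E}.
Context {V : rieszClosed E}.
Context {dU : sub_of U -> sub_of U -> R} {dV : sub_of V -> sub_of V -> R}.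
Hypothesis fs : metric_fstructure dU dV.

Lemma smul_small (z : sub_of V) (e : R) : 0 < e -> exists2 r : R, 0 < r &
  forall u : sub_of U, dU u 0 < r -> dV (smul V u z) 0 < e.
Proof.
move=> e0; have [r r0 rP] := fs_mul fs 0 z e0; exists r => // u ur.
have dd := mr_distance (fs_metricV fs).
have ddU := mr_distance (mf_metric (fs_metricU fs)).
have -> : 0 = smul V (0 : sub_of U) z :> sub_of V.
  by apply: val_inj; rewrite val_smul ?mul0r//; exact: fs_mulset fs.
rewrite (dist_sym dd); apply: rP; rewrite (dist_sym ddU).
by rewrite ((dist_eq0 dd z z).2 erefl) addr0.
Qed.

Lemma scale_small (z : sub_of V) (e : R) : 0 < e -> exists2 r : R, 0 < r &
  forall t : R, 0 < t -> t < r -> dV (t *: z) 0 < e.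
Proof.
move=> e0; have [r r0 rP] := smul_small z e0.
have /cvgrPdist_lt/(_ r r0) := mf_unit (fs_metricU fs).
move=> /nbhs_ballP[q /= q0 qP]; exists q => // t t0 tq.
have -> : t *: z = smul V (t *: (1 : sub_of U) : sub_of U) z.
  by apply: val_inj; rewrite val_smul ?(fs_mulset fs)//= -scaler_one.
apply: rP.
have := qP t; rewrite /ball /= sub0r normrN gtr0_norm// => /(_ tq t0).
by rewrite sub0r normrN ger0_norm// (dist_ge0 (mr_distance (mf_metric (fs_metricU fs)))).
Qed.

End MetricFStructure.

(** * Homogeneity over the algebra of scalars *)

Section PolarBilinear.
Context {R : realType} {E : fAlgType R} {U : fsubalgClosed E}.
Context {V Z : rieszClosed E} {H : lmodType (sub_of U)} {nrm : H -> sub_of V}.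
Context {dU : sub_of U -> sub_of U -> R} {dZ : sub_of Z -> sub_of Z -> R}.
Hypothesis sc : dedekind_sigma_complete E.
Hypothesis nm : normed_module nrm.
Hypothesis parallelogram : forall v w, sqnorm nrm (v + w) + sqnorm nrm (v - w)
  = sqnorm nrm v *+ 2 + sqnorm nrm w *+ 2.
Hypothesis fs : metric_fstructure dU dZ.
Hypothesis VV : mulset V V = [set x | x \in Z].

(** The defect [polar (u *: v) w - u * polar v w] is additive in [u], vanishes
    for simple [u], and is dominated by a multiple of [u]: density of the simple
    elements makes it vanish. *)
Lemma polar_scale (u : sub_of U) v w :
  polar nrm (u *: v) w = \val u * polar nrm v w.
Proof.
have mUZ := fs_mulset fs.
have mdZ := fs_metricV fs.
have mdU := mf_metric (fs_metricU fs).
pose P x y : sub_of Z := normsq Z nrm (x + y) - normsq Z nrm x - normsq Z nrm y.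
have PE x y : \val (P x y) = polar nrm x y by rewrite /= !val_smul.
pose D : sub_of Z := P (u *: v) w - smul Z u (P v w).
have DE : \val D = polar nrm (u *: v) w - \val u * polar nrm v w.
  by rewrite -!PE [\val D]/(\val (P _ _) - \val (smul Z u (P v w))) val_smul.
suff : D = 0.
  by move/(congr1 val)/eqP; rewrite DE subr_eq0 => /eqP.
pose z : sub_of Z := smul Z (nrm v) (nrm w) *+ 4.
have zE : \val z = \val (nrm v) * \val (nrm w) *+ 4.
  by rewrite -(val_smul _ _ VV).
apply: (dist_small_eq0 mdZ) => e /(smul_small fs z)[r r0 rP].
have [s ss us] := mf_dense (fs_metricU fs) u r0.
apply: le_lt_trans (rP (rabs (u - s)) _); last first.
  by rewrite -(mr_abs mdU) (dist_subr mdU).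
apply: (dist_rabs_le mdZ).
suff : rabs (\val D) <= \val (smul Z (rabs (u - s)) z) by [].
rewrite val_smul// zE DE.
have -> : polar nrm (u *: v) w - \val u * polar nrm v w =
    polar nrm ((u - s) *: v) w - \val (u - s) * polar nrm v w.
  rewrite -[in LHS](subrK s u) scalerDl (polarDl parallelogram).
  rewrite (polar_simple sc nm parallelogram _ _ ss) /=; ring.
exact: polar_scale_bound.
Qed.

End PolarBilinear.



(** * The energy of a functional and its near-minimizers *)

Section Energy.
Context {R : realType} {E : fAlgType R} {U : fsubalgClosed E}.
Context {V Z : rieszClosed E} {H : lmodType (sub_of U)} {nrm : H -> sub_of V}.
Hypothesis sc : dedekind_sigma_complete E.
Hypothesis nm : normed_module nrm.
Hypothesis parallelogram : forall v w, sqnorm nrm (v + w) + sqnorm nrm (v - w)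
  = sqnorm nrm v *+ 2 + sqnorm nrm w *+ 2.
Hypothesis VV : mulset V V = [set x | x \in Z].
Local Notation N v := (\val (nrm v)).
Local Notation Q := (sqnorm nrm).

Variables (om : H -> sub_of Z) (b : sub_of V).
Hypothesis omD : forall v w, om (v + w) = om v + om w.
Hypothesis omZ : forall (u : sub_of U) v, \val (om (u *: v)) = \val u * \val (om v).
Hypothesis omb : dual_bound nrm om b.

(** A minimizer [h] satisfies [2 * (om v) = polar h v] for every [v], that is, it
    represents [om]. *)
Definition energy v : sub_of Z := normsq Z nrm v - om v *+ 2.

Lemma val_energy v : \val (energy v) = Q v - \val (om v) *+ 2.
Proof. by rewrite /= val_smul. Qed.

Local Notation B := (\val b).

Lemma bound_ge0 : 0 <= B.
Proof. by have [] := omb. Qed.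

Lemma om_le v : \val (om v) <= B * N v.
Proof. by have [_ /(_ v)] := omb; apply: le_trans; exact: ler_rabs. Qed.

Lemma om0 : om 0 = 0.
Proof. by apply: (addrI (om 0)); rewrite -omD !addr0. Qed.

Lemma omN v : om (- v) = - om v.
Proof. by apply/eqP; rewrite -subr_eq0 opprK -omD addNr om0. Qed.

Lemma energy0 : energy 0 = 0.
Proof.
by apply: val_inj; rewrite val_energy (sqnorm0 nm) om0 /= mul0rn subr0.
Qed.

(** Completing the square. *)
Lemma energy_lb v : - smul Z b b <= energy v.
Proof.
suff : - \val (smul Z b b) <= \val (energy v) by [].
rewrite val_smul// val_energy -riesz_subr_ge0.
have -> : Q v - \val (om v) *+ 2 - - (B * B) =
  (N v - B) * (N v - B) + (B * N v - \val (om v)) *+ 2.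
  by rewrite /sqnorm; ring.
apply: riesz_addr_ge0; first exact: fsqr_ge0.
by apply: riesz_mulrn_ge0; rewrite riesz_subr_ge0 om_le.
Qed.

(** Countable representability turns the infimum of all energies into that of a
    sequence.  Prefixing [0] keeps the sequence minimizing, and bounds its first
    excess energy by [b ^ 2], as [egorov_partition] requires. *)
Lemma minimizing_sequence : countably_representable (sub_of Z) ->
  exists (m : sub_of Z) (v : nat -> H), [/\ v 0%N = 0, forall x, m <= energy x &
    forall y, (forall n, y <= energy (v n)) -> y <= m].
Proof.
move=> [dc cr].
have ne : range energy !=set0 by exists (energy 0), 0.
have lb : has_lbound (range energy).
  by exists (- smul Z b b) => _ [v _ <-]; exact: energy_lb.
have [_ /(_ lb)[m mP]] := dc _ ne.
have [_ /(_ lb)[s sS sm]] := cr _ ne.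
have /choice[v vP] n : exists v, energy v = s n.
  by have [|v _ <-] := sS (s n); [exists n|exists v].
exists m, (fun n => if n is k.+1 then v k else 0); split=> // [x|y ym].
  by have [mlb _] := mP; apply: mlb; exists x.
move: mP; rewrite -sm => -[_]; apply => _ [n _ <-].
by rewrite -vP; exact: (ym n.+1).
Qed.

(** The infimum is approached only in order, not in the metric, and at different
    speeds at different points.  The elements of a minimizing sequence are
    therefore glued along the sets where their excess energy first drops below
    the threshold [t ^ 2 * b ^ 2]; the glued element exists because an element
    with so little energy has norm at most [3 * b] there. *)
Lemma near_minimizer (m : sub_of Z) (v : nat -> H) (t : R) :
  solid U -> solid Z ->
  v 0%N = 0 -> (forall x, m <= energy x) ->
  (forall y, (forall n, y <= energy (v n)) -> y <= m) ->
  0 < t -> t <= 1 ->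
  exists h, \val (energy h) - \val m <= (t * t) *: (B * B).
Proof.
move=> solidU solidZ v0 mlb minf t0 t1.
have B0 := bound_ge0.
have BB0 : 0 <= B * B := fsqr_ge0 _.
have tt0 : 0 < t * t by exact: mulr_gt0.
pose x n := \val (energy (v n)) - \val m.
pose z := (t * t) *: (B * B).
have z0 : 0 <= z by apply: riesz_scale_ge0 => //; exact: ltW.
have zBB : z <= B * B.
  rewrite -riesz_subr_ge0 -[X in X - _]scale1r -scalerBl.
  by apply: riesz_scale_ge0 => //; rewrite subr_ge0 mulr_ile1// ltW.
have x0 n : 0 <= x n by rewrite riesz_subr_ge0; exact: mlb.
have m0 : \val m <= 0 by have := mlb 0; rewrite energy0.
have xz : x 0%N <= (t * t)^-1 *: z.
  rewrite /z scalerA mulVf ?gt_eqF// scale1r /x v0 energy0 sub0r.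
  rewrite -riesz_subr_ge0 opprK addrC.
  have /minf : forall n, - smul Z b b <= energy (v n) by move=> n; exact: energy_lb.
  rewrite -riesz_subr_ge0 opprK => h.
  have {h} : 0 <= \val m + \val (smul Z b b) := h.
  by rewrite val_smul.
have zZ : z \in Z.
  by rewrite /z -(val_smul b b VV); exact: (valP ((t * t) *: smul Z b b)).
have [//|e [ep ex]] := egorov_partition sc solidU z0 x0 xz.
  move=> y y0 yz yx.
  have yZ : y \in Z by apply: (solidZ z); rewrite ?rabs_id// (le_trans y0).
  have /minf : forall n, m + SubOf yZ <= energy (v n).
    move=> n; suff : \val m + y <= \val (energy (v n)) by [].
    have := yx n; rewrite -(riesz_subr_ge0 y) -(riesz_subr_ge0 (\val m + y)) /x.
    by rewrite opprD addrA.
  by rewrite riesz_gerDl => le0; apply/le_anti; rewrite y0 andbT.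
have eid n : \val (e n) * \val (e n) = \val (e n).
  by have [/(_ n)/(congr1 val)] := ep.
have e0 n := idempotent_ge0 (eid n).
have e1 n := idempotent_le1 (eid n).
have [|h hP] := nm_glue nm (v := v) ep.
  split.
    exists (b *+ 3) => _ [n _ <-].
    suff : N (e n *: v n) <= B *+ 3 by [].
    have N0 := nrm_ge0 nm (e n *: v n).
    (* [(N - 3 * B) * (N + B) = N ^ 2 - 2 * B * N - 3 * B ^ 2] for the norm [N]
       of [e n *: v n], and the energy bounds [N ^ 2 - 2 * B * N]. *)
    apply: (le_of_mul_le0 sc (r := N (e n *: v n) + B)).
    - exact: riesz_addr_ge0.
    - rewrite -riesz_subr_ge0.
      have -> : N (e n *: v n) + B - (N (e n *: v n) - B *+ 3) = B *+ 4 by ring.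
      exact: riesz_mulrn_ge0.
    have Ne : N (e n *: v n) = \val (e n) * N (v n).
      by rewrite (nm_scale nm) rabs_id.
    have := ex n.
    rewrite -riesz_subr_ge0 -riesz_oppr_le0E; apply: le_trans.
    rewrite -riesz_subr_ge0 Ne /x val_energy /sqnorm -/z.
    set a := N (v n); set o := \val (om (v n)); set e' := \val (e n).
    have -> : - (e' * z - e' * (a * a - o *+ 2 - \val m)) -
        (e' * a - B *+ 3) * (e' * a + B) =
      e' * (- \val m) + (e' * (B * a - o)) *+ 2 + (B * B - e' * z)
       + (B * B) *+ 2 + (e' - e' * e') * (a * a) by ring.
    rewrite eid subrr mul0r addr0.
    apply: riesz_addr_ge0; last exact: riesz_mulrn_ge0.
    apply: riesz_addr_ge0; last first.
      rewrite riesz_subr_ge0; apply: le_trans zBB.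
      by rewrite -[leRHS]mul1r; exact: fmul_le z0 (e1 n).
    apply: riesz_addr_ge0.
      by apply: rmul_ge0; [exact: e0|rewrite -riesz_oppr_le0E opprK].
    apply: riesz_mulrn_ge0; apply: rmul_ge0; first exact: e0.
    by rewrite riesz_subr_ge0 om_le.
  by exists 0 => _ [n _ <-]; exact: (nm_ge0 nm).
exists h.
have eF n : \val (e n) * \val (energy h) = \val (e n) * \val (energy (v n)).
  have en : idempotents (e n) by have [] := ep.
  by rewrite !val_energy !mulrBr !mulrnAr !(sqnorm_idem nm _ en) -!omZ hP.
set y := \val (energy h) - \val m - z.
suff : pospart y = 0.
  by move/pospart_eq0; rewrite riesz_subr_le0.
apply: (fsqr_eq0 sc); first exact: pospart_ge0.
apply: (partition_separates solidU ep); first exact: fsqr_ge0.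
move=> n; rewrite -mul_pospart.
apply/le_anti/andP; split; last first.
  by rewrite mul_pospart; apply: rmul_ge0 => //; exact: fsqr_ge0.
have -> : \val (e n) * (pospart y * y) =
  (\val (e n) * \val (energy h) - \val (e n) * \val m - \val (e n) * z)
    * pospart y by rewrite /y; ring.
rewrite eF -mulrBr -(mul0r (pospart y)); apply: fmul_le.
  exact: pospart_ge0.
by rewrite riesz_subr_le0; exact: ex.
Qed.

(** The parallelogram law, with the energy of the midpoint bounded below by
    [m]. *)
Lemma sqnorm_sub_le (m : sub_of Z) : (forall x, m <= energy x) ->
  forall v w, Q (v - w) <=
    (\val (energy v) - \val m) *+ 2 + (\val (energy w) - \val m) *+ 2.
Proof.
move=> mlb v w.
pose u : sub_of U := (2^-1 : R) *: (1 : sub_of U).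
have uu : \val u + \val u = 1 := riesz_halfD 1.
have : 0 <= (\val (energy (u *: (v + w))) - \val m) *+ 4.
  by apply: riesz_mulrn_ge0; rewrite riesz_subr_ge0; exact: mlb.
rewrite !val_energy (sqnorm_scale nm) omZ omD.
have -> : \val (om v + om w) = \val (om v) + \val (om w) by [].
rewrite -(riesz_subr_ge0 (Q (v - w))).
have -> : Q (v - w) = Q v *+ 2 + Q w *+ 2 - Q (v + w).
  by rewrite -parallelogram addrAC subrr add0r.
set h := \val u in uu *.
have -> : (h * h * Q (v + w) - (h * (\val (om v) + \val (om w))) *+ 2 - \val m) *+ 4
  = (h + h) * (h + h) * Q (v + w) - (h + h) * (\val (om v) + \val (om w)) *+ 4
    - \val m *+ 4 by ring.
rewrite uu !mul1r.
set o := \val (om v); set o' := \val (om w).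
by congr (0 <= _); ring.
Qed.

End Energy.

Arguments energy {R E U V Z H} nrm om v.



(** * The representation theorem *)

Lemma infimum_min (R : realType) (E : rieszType R) (A : set E) x x0 :
  A x -> lbound A x -> infimum x0 A = x.
Proof.
move=> Ax lbx.
have infx : infimums A x by split=> // y; exact.
rewrite /infimum ifF; last by apply/negbTE/set0P; exists x.
exact: (is_subset1_infimums (xgetPex _ (ex_intro _ x infx)) infx).
Qed.

Lemma hilbert_module_transport (R : realType) (E : fAlgType R)
    (U : fsubalgClosed E) (V Z : rieszClosed E) (dV : sub_of V -> sub_of V -> R)
    (M M' : lmodType (sub_of U)) (nrm : M -> sub_of V) (nrm' : M' -> sub_of V)
    (Phi : M -> M') :
  banach_isomorphism nrm nrm' Phi -> hilbert_module Z dV nrm ->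
  hilbert_module Z dV nrm'.
Proof.
move=> [lin [Psi PsiK PhiK] iso] [[nm cplt] par].
pose L : {linear M -> M'} := HB.pack Phi (GRing.isLinear.Build _ _ _ _ Phi lin).
have PhiD x y : Phi (x + y) = Phi x + Phi y := linearD L x y.
have PhiB x y : Phi (x - y) = Phi x - Phi y := linearB L x y.
have PhiZ a x : Phi (a *: x) = a *: Phi x := linearZ_LR L a x.
have Phi0 : Phi 0 = 0 := linear0 L.
have nrm'E f : nrm' f = nrm (Psi f) by rewrite -[in LHS](PhiK f) iso.
have PsiD f g : Psi (f + g) = Psi f + Psi g.
  by apply: (can_inj PsiK); rewrite PhiD !PhiK.
have PsiB f g : Psi (f - g) = Psi f - Psi g.
  by apply: (can_inj PsiK); rewrite PhiB !PhiK.
have PsiZ a f : Psi (a *: f) = a *: Psi f.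
  by apply: (can_inj PsiK); rewrite PhiZ !PhiK.
split; last by move=> f g; rewrite /normsq !nrm'E PsiD PsiB; exact: par.
split; last first.
  move=> s sC; have [|l ll] := cplt (Psi \o s).
    move=> e /sC[n nP]; exists n => i j ni nj; have := nP i j ni nj.
    by rewrite /module_distance nrm'E PsiB.
  exists (Phi l); rewrite (_ : (fun n => _) =
    (fun n => module_distance dV nrm ((Psi \o s) n) l))//.
  by apply/funext => n; rewrite /module_distance nrm'E PsiB PsiK.
split=> [f|f|f g|u f|u f up ob].
- by rewrite nrm'E; exact: (nm_ge0 nm).
- rewrite nrm'E; split=> [/(nm_eq0 nm) f0|->]; first by rewrite -(PhiK f) f0.
  by apply/(nm_eq0 nm)/(can_inj PsiK); rewrite PhiK Phi0.
- by rewrite !nrm'E PsiD; exact: (nm_triangle nm).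
- by rewrite !nrm'E PsiZ (nm_scale nm).
- have [|w wP] := nm_glue nm (v := Psi \o f) up.
    by congr (order_bounded _): ob; apply/funext => n; rewrite nrm'E PsiZ.
  by exists (Phi w) => n; rewrite -PhiZ wP PhiZ PhiK.
Qed.

Section Representation.
Context {R : realType} {E : fAlgType R} {U : fsubalgClosed E}.
Context {V Z : rieszClosed E}.
Context {dU : sub_of U -> sub_of U -> R} {dV : sub_of V -> sub_of V -> R}.
Context {dZ : sub_of Z -> sub_of Z -> R}.
Hypothesis HS : cr_dual_system dU dV dV dZ.
Context {H : lmodType (sub_of U)} {nrm : H -> sub_of V}.
Hypothesis hH : hilbert_module Z dV nrm.

Local Notation N v := (\val (nrm v)).
Local Notation Q := (sqnorm nrm).
Local Notation cds := (crds_complete HS).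

Let fsV : metric_fstructure dU dV := ds_V (cds_system cds).
Let fsZ : metric_fstructure dU dZ := ds_Z (cds_system cds).
Let sc : dedekind_sigma_complete E := loc_complete (fs_localisable fsV).
Let nm : normed_module nrm := hH.1.1.
Let VV : mulset V V = [set x | x \in Z] := ds_mulset (cds_system cds).

Lemma sqnorm_parallelogram v w :
  Q (v + w) + Q (v - w) = Q v *+ 2 + Q w *+ 2.
Proof. by have /(congr1 val) := hH.2 v w; rewrite /= !val_smul. Qed.
Let par := sqnorm_parallelogram.

Let polarZl := polar_scale sc nm par fsZ VV.

Lemma val_scalar_product v w :
  \val (scalar_product Z nrm v w) = (2^-1 : R) *: polar nrm v w.
Proof. by rewrite /= !val_smul. Qed.

(** A minimizer [h] of the energy is a limit in the metric: near-minimizers [s j]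
    with excess at most [(b / j.+1) ^ 2] are Cauchy because their mutual
    distances are dominated by small multiples of the single element [b].  The
    pointwise estimates pass to the limit and yield the Euler-Lagrange
    equation. *)
Lemma riesz_representation (om : H -> sub_of Z) (b : sub_of V) :
  (forall v w, om (v + w) = om v + om w) ->
  (forall (u : sub_of U) v, \val (om (u *: v)) = \val u * \val (om v)) ->
  dual_bound nrm om b ->
  exists h, forall v, om v = scalar_product Z nrm v h.
Proof.
move=> omD omZ omb.
have [_ _ crZ] := (crds_Z HS).2.
have [m [v0 [v00 mlb minf]]] := minimizing_sequence VV omb crZ.
pose t j : R := j.+1%:R^-1.
have t0 j : 0 < t j by rewrite invr_gt0.
have t1 j : t j <= 1 by rewrite invf_le1// ler1n.
have tle i j : (i <= j)%N -> t j <= t i by move=> ij; rewrite lef_pV2 ?posrE// ler_nat.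
pose B := \val b.
have B0 : 0 <= B := bound_ge0 omb.
have BB0 : 0 <= B * B := fsqr_ge0 _.
have /choice[s sP] j := near_minimizer sc nm VV omD omZ omb (fs_solidU fsV)
  (fs_solidV fsZ) v00 mlb minf (t0 j) (t1 j).
have sN i j k : (k <= i)%N -> (k <= j)%N -> N (s i - s j) <= (t k *+ 2) *: B.
  move=> ki kj; apply: (le_of_sqr sc); first exact: (nrm_ge0 nm).
    by apply: riesz_scale_ge0; rewrite ?mulrn_wge0// ltW.
  apply: le_trans (sqnorm_sub_le nm par VV omD omZ mlb _ _) _.
  have bd l : (k <= l)%N ->
      \val (energy nrm om (s l)) - \val m <= (t k * t k) *: (B * B).
    move=> kl; apply: le_trans (sP l) _.
    rewrite -riesz_subr_ge0 -scalerBl; apply: riesz_scale_ge0 => //.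
    by rewrite subr_ge0 ler_pM ?(ltW (t0 l))// tle.
  have := riesz_leD (riesz_leD (bd i ki) (bd i ki)) (riesz_leD (bd j kj) (bd j kj)).
  rewrite -!mulr2n => /le_trans; apply.
  rewrite -scalerA -scalerMnl (scaler_one (t k) (B * B)).
  rewrite (scaler_one (t k) (_ * _)) (scaler_one (t k) B) le_eqVlt.
  by apply/orP; left; apply/eqP; ring.
have [h hlim] : exists h, module_distance dV nrm (s n) h @[n --> \oo] --> (0 : R).
  apply: hH.1.2 => e e0; have [r r0 rP] := scale_small fsV b e0.
  exists (Num.truncn (2 / r)) => i j ki kj.
  apply: le_lt_trans (rP (t (Num.truncn (2 / r)) *+ 2) _ _).
  - apply: (dist_rabs_le (fs_metricV fsV)).
    by rewrite rabs_id; [exact: sN ki kj|exact: (nm_ge0 nm)].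
  - by rewrite pmulrn_lgt0.
  - by rewrite -(mulr_natl (t _) 2) /t ltr_pdivrMr// mulrC -ltr_pdivrMr// truncnS_gt.
have sh j : N (s j - h) <= (t j *+ 2) *: B.
  suff /pospart_eq0 : pospart (nrm (s j - h) - (t j *+ 2) *: b) = 0.
    by rewrite riesz_subr_le0.
  apply: (dist_small_eq0 (fs_metricV fsV)) => e e0.
  have /cvgrPdist_lt/(_ e e0)[n _ nP] := hlim.
  have /= := nP (maxn n j) (leq_maxl _ _).
  rewrite sub0r normrN => /(le_lt_trans (ler_norm _)); apply: le_lt_trans.
  apply: (dist_rabs_le (fs_metricV fsV)).
  rewrite rabs_id ?pospart_ge0//; apply: pospart_le; first exact: (nm_ge0 nm).
  rewrite -riesz_subr_le0 addrAC riesz_subr_le0.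
  suff : N (s j - h) - N (s (maxn n j) - h) <= (t j *+ 2) *: B by [].
  apply: le_trans (sN j (maxn n j) j (leqnn _) (leq_maxr _ _)).
  rewrite -riesz_subr_le0 -addrA -opprD riesz_subr_le0 [leRHS]addrC.
  have -> : s j - h = (s j - s (maxn n j)) + (s (maxn n j) - h) by rewrite subrKA.
  exact: (nrm_triangle nm).
(* Perturbing [s j] by [t j *: v] changes the energy by
   [t j * (polar (s j) v - 2 * om v)] up to terms of order [t j ^ 2]. *)
have EL v : 0 <= polar nrm h v - \val (om v) *+ 2.
  pose C := Q v + B * B + (B * N v) *+ 4.
  have C0 : 0 <= C.
    apply: riesz_addr_ge0; first by apply: riesz_addr_ge0 => //; exact: fsqr_ge0.
    by apply/riesz_mulrn_ge0/rmul_ge0 => //; exact: (nrm_ge0 nm).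
  rewrite -riesz_oppr_le0E; apply: (riesz_archimedean sc (y := C)) => -[//|j].
  pose d := t j *: (1 : E).
  have d0 : 0 <= d by apply: riesz_scale_ge0; [exact: ltW|exact: one_ge0].
  have dn : j.+1%:R * d = 1.
    have tj1 : t j *+ j.+1 = 1 by rewrite -(mulr_natl (t j)) mulfV// pnatr_eq0.
    by rewrite mulr_natl /d scalerMnl tj1 scale1r.
  pose u : sub_of U := t j *: (1 : sub_of U).
  have uE : \val u = d by [].
  have step : 0 <= d * (polar nrm (s j) v - \val (om v) *+ 2)
                   + d * d * (Q v + B * B).
    have ge1 : \val m <= \val (energy nrm om (s j + u *: v)) := mlb _.
    have := sP j; rewrite -scalerA (scaler_one (t j) (_ * _)) -/d.
    rewrite (scaler_one (t j) (_ * _)) -/d.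
    rewrite -riesz_subr_ge0 => ge2; move: ge1; rewrite -riesz_subr_ge0 => ge1.
    have := riesz_addr_ge0 ge1 ge2.
    have QE : Q (s j + u *: v) =
        d * polar nrm (s j) v + Q (s j) + d * d * Q v.
      rewrite -uE -(sqnorm_scale nm) (polarC nrm (s j)) -polarZl.
      by rewrite (polarC nrm _ (s j)) /polar; ring.
    have omE : \val (om (s j + u *: v)) = \val (om (s j)) + d * \val (om v).
      by rewrite omD -uE -omZ.
    rewrite !val_energy// QE omE; set q := Q _; set o := \val (om (s j)).
    by congr (0 <= _); rewrite -/B; ring.
  have step2 : polar nrm (s j) v <= polar nrm h v + d * (B * N v) *+ 4.
    rewrite -[in leLHS](subrK h (s j)) (polarDl par) addrC.
    apply: riesz_leD => //; apply: le_trans (polar_le nm _ _) _.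
    have := fmul_le (nrm_ge0 nm v) (sh j); rewrite -scalerMnl (scaler_one (t j) B) -/d.
    move=> le2; have := riesz_leD le2 le2; rewrite mulr2n => /le_trans; apply.
    by rewrite le_eqVlt; apply/orP; left; apply/eqP; ring.
  have step3 : 0 <= (d * (polar nrm h v - \val (om v) *+ 2) + d * d * C) *+ j.+1 *+ j.+1.
    do 2!apply: riesz_mulrn_ge0; apply: le_trans step _.
    rewrite -riesz_subr_ge0 /C.
    have : 0 <= d * (polar nrm h v + d * (B * N v) *+ 4 - polar nrm (s j) v).
      by apply: rmul_ge0 => //; rewrite riesz_subr_ge0.
    by congr (0 <= _); ring.
  rewrite -riesz_subr_ge0; move: step3; congr (0 <= _).
  set y := polar _ _ _ - _; rewrite mulNrn opprK.
  have -> : (d * y + d * d * C) *+ j.+1 *+ j.+1 =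
      (j.+1%:R * d) * (y *+ j.+1) + (j.+1%:R * d) * (j.+1%:R * d) * C.
    rewrite -(mulr_natl (d * y + _)) -(mulr_natl (_ * (_ + _))) -(mulr_natl y).
    by set K := _%:R; ring.
  by rewrite dn !mul1r addrC.
exists h => v; apply: val_inj; rewrite val_scalar_product polarC.
have -> : polar nrm h v = \val (om v) *+ 2.
  apply/le_anti/andP; split; last by rewrite -riesz_subr_ge0; exact: EL.
  rewrite -riesz_subr_ge0; have := EL (- v).
  rewrite polarC (polarNl nm par) (polarC nrm v) (omN omD) /=.
  by rewrite mulNrn opprK addrC.
by rewrite riesz_half_mul2.
Qed.

Lemma scalar_product_bound w :
  dual_bound nrm (fun v => scalar_product Z nrm v w) (nrm w).
Proof.
split=> [|v]; first exact: (nm_ge0 nm).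
have half x y : x <= y *+ 2 -> (2^-1 : R) *: x <= y :> E.
  rewrite -riesz_subr_ge0 => /(riesz_scale_ge0 (2^-1 : R)).
  rewrite scalerBr riesz_half_mul2 riesz_subr_ge0; apply.
  by rewrite invr_ge0 ler0n.
suff : rabs (\val (scalar_product Z nrm v w)) <= N w * N v by [].
rewrite val_scalar_product; apply: rabs_le.
  by apply: half; rewrite [N w * _]mulrC; exact: (polar_le nm).
rewrite -scalerN -(polarNl nm par) -(nrmN nm v).
by apply: half; rewrite [N w * _]mulrC; exact: (polar_le nm).
Qed.

Lemma scalar_product_dual w :
  (fun v => scalar_product Z nrm v w) \in dual_pred V nrm.
Proof.
apply/asboolP; split=> [v v'|u v|].
- apply: val_inj; rewrite [RHS]/(\val (scalar_product Z nrm v w) +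
    \val (scalar_product Z nrm v' w)).
  by rewrite !val_scalar_product (polarDl par) scalerDr.
- by rewrite !val_scalar_product polarZl mulr_scaler.
- by exists (nrm w); exact: scalar_product_bound.
Qed.

Definition riesz_map (w : H) : dual cds nrm :=
  DualFunctional (scalar_product_dual w).

(** The bound [nrm w] of the functional is attained at [w] itself. *)
Lemma dual_norm_riesz_map w : dual_norm cds nrm (riesz_map w) = nrm w.
Proof.
apply: infimum_min; first exact: scalar_product_bound.
move=> a [a0 /(_ w) aw].
suff : N w <= \val a by [].
have {}a0 : 0 <= \val a := a0.
have w0 := nrm_ge0 nm w.
apply: (le_of_mul_le0 sc w0); first by rewrite -riesz_subr_ge0 opprB addrC subrK.
rewrite mulrBl riesz_subr_le0; apply: le_trans aw.
apply: le_trans (ler_rabs _).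
suff -> : \val (scalar_product Z nrm w w) = N w * N w by [].
by rewrite val_scalar_product (polar_self nm par) riesz_half_mul2.
Qed.

Lemma riesz_map_linear : linear riesz_map.
Proof.
move=> u v w; apply: val_inj; apply/funext => x; apply: val_inj.
rewrite [LHS]val_scalar_product.
rewrite [RHS]/(\val (smul Z u (scalar_product Z nrm x v)) +
  \val (scalar_product Z nrm x w)).
rewrite val_smul; last exact: fs_mulset fsZ.
rewrite !val_scalar_product polarC (polarDl par) polarZl !(polarC nrm _ x).
by rewrite scalerDr mulr_scaler.
Qed.

Lemma riesz_map_isomorphism :
  banach_isomorphism nrm (dual_norm cds nrm) riesz_map.
Proof.
split; [exact: riesz_map_linear| |exact: dual_norm_riesz_map].
have /choice[g gK] (f : dual cds nrm) : exists h, riesz_map h = f.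
  have /asboolP[fD fZ [b fb]] := valP f.
  have [h hP] := riesz_representation fD fZ fb.
  by exists h; apply: val_inj; apply/funext => v; rewrite /= -hP.
exists g => // w.
pose L : {linear H -> dual cds nrm} :=
  HB.pack riesz_map (GRing.isLinear.Build _ _ _ _ riesz_map riesz_map_linear).
apply/eqP; rewrite -subr_eq0; apply/eqP/(nm_eq0 nm).
rewrite -dual_norm_riesz_map.
have -> : riesz_map (g (riesz_map w) - w) = riesz_map 0.
  by rewrite [LHS](linearB L) /= gK subrr [RHS](linear0 L).
by rewrite dual_norm_riesz_map; exact/(nm_eq0 nm).
Qed.

End Representation.

Theorem theorem3p38 (R : realType) (E : fAlgType R) (U : fsubalgClosed E)
    (V Z : rieszClosed E)
    (dU : sub_of U -> sub_of U -> R) (dV : sub_of V -> sub_of V -> R)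
    (dZ : sub_of Z -> sub_of Z -> R)
    (HS : cr_dual_system dU dV dV dZ)
    (H : lmodType (sub_of U)) (nrm : H -> sub_of V)
    (hH : hilbert_module Z dV nrm)
    (hle : forall v : H,
       module_distance dV nrm v 0 ^+ 2 <= dZ (normsq Z nrm v) 0) :
  exists RH : H -> dual (crds_complete HS) nrm,
    [/\ forall v w : H, pairing (RH w) v = scalar_product Z nrm v w,
        banach_isomorphism nrm (dual_norm (crds_complete HS) nrm) RH,
        hilbert_module Z dV (dual_norm (crds_complete HS) nrm) &
        forall v w : H,
          scalar_product Z (dual_norm (crds_complete HS) nrm) (RH v) (RH w) =
          scalar_product Z nrm v w].
Proof.
have iso := riesz_map_isomorphism HS hH.
exists (riesz_map HS hH); split=> // [|v w].
  exact: hilbert_module_transport iso hH.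
rewrite /scalar_product /normsq !dual_norm_riesz_map.
have [lin _ _] := iso.
have -> : riesz_map HS hH v + riesz_map HS hH w = riesz_map HS hH (v + w).
  by have := lin 1 v w; rewrite !scale1r.
by rewrite dual_norm_riesz_map.
Qed.
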